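(* Let $\nu$ be a Thorin measure on $\mathbb{R}_+^d$ satisfying the additional integrability condition $$\int_{\mathbb{R}_+^d}\|s\|\,\nu(\mathrm{d}s)<\infty,$$ and let $X\sim\mathcal{G}_d(\nu)$. Let $\mathcal{F}_\nu$ be the class of Borel-measurable functions $f:\mathbb{R}^d\to\mathbb{R}^d$ for which both sides of the identity $(\ast)$ below are absolutely convergent, i.e. $$\mathbb{E}\bigl[|\langle X,f(X)\rangle|\bigr]<\infty\quad\text{and}\quad \int_{\mathbb{R}_+^d}\int_0^\infty e^{-z}\,\mathbb{E}\bigl[|\langle s,f(X+zs)\rangle|\bigr]\,\mathrm{d}z\,\nu(\mathrm{d}s)<\infty.$$ Then the operator $$(\mathcal{T}_\nu f)(x)=\langle x,f(x)\rangle-\int_{\mathbb{R}_+^d}\int_0^\infty e^{-z}\langle s,f(x+zs)\rangle\,\mathrm{d}z\,\nu(\mathrm{d}s)=\langle x,f(x)\rangle-\int_{\mathbb{R}_+^d}\mathbb{E}\bigl[\langle s,f(x+sE)\rangle\bigr]\,\nu(\mathrm{d}s),$$ where $E\sim\mathrm{Exp}(1)$ (defined at every $x$ where the integral converges absolutely), is a Stein operator for $X$ on $\mathcal{F}_\nu$, that is, $\mathbb{E}[(\mathcal{T}_\nu f)(X)]=0$ for every $f\in\mathcal{F}_\nu$. Equivalently, for every $f\in\mathcal{F}_\nu$, $$(\ast)\qquad \mathbb{E}\bigl[\langle X,f(X)\rangle\bigr]=\int_{\mathbb{R}_+^d}\int_0^\infty e^{-z}\,\mathbb{E}\bigl[\langle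 s,f(X+zs)\rangle\bigr]\,\mathrm{d}z\,\nu(\mathrm{d}s).$$
   Context: $d\ge 1$ is a fixed integer, $\mathbb{R}_+=[0,\infty)$, $\langle\cdot,\cdot\rangle$ and $\|\cdot\|$ are the Euclidean scalar product and norm. A Thorin measure on $\mathbb{R}_+^d$ is a positive Radon measure $\nu$ on $\mathbb{R}_+^d$ with $\int_{\{\|s\|\le 1\}}|\log\|s\||\,\nu(\mathrm{d}s)<\infty$ and $\int_{\{\|s\|>1\}}\|s\|^{-1}\,\nu(\mathrm{d}s)<\infty$ (with $|\log 0|=+\infty$, so $\nu(\{0\})=0$). A random vector $X$ with values in $\mathbb{R}_+^d$ is a multivariate generalized gamma convolution with Thorin measure $\nu$, written $X\sim\mathcal{G}_d(\nu)$, if its characteristic function $\varphi_X(t)=\mathbb{E}[e^{\mathrm{i}\langle t,X\rangle}]$ satisfies $\log\varphi_X(t)=-\int_{\mathbb{R}_+^d}\log(1-\mathrm{i}\langle s,t\rangle)\,\nu(\mathrm{d}s)$ for all $t\in\mathbb{R}^d$ (principal branch of the logarithm under the integral). $\mathrm{Exp}(1)$ is the exponential distribution with density $z\mapsto e^{-z}$ on $(0,\infty)$. *)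

(* Defs.v *)
From HB Require Import structures.
From mathcomp Require Import all_boot all_order all_algebra.
From mathcomp Require Import complex.
From mathcomp Require Import all_classical all_reals all_analysis.

Set Implicit Arguments.
Unset Strict Implicit.
Unset Printing Implicit Defensive.

Import Order.TTheory GRing.Theory Num.Theory.
Import numFieldNormedType.Exports.

Local Open Scope classical_set_scope.
Local Open Scope ring_scope.
Local Open Scope complex_scope.

(* R^d is 'rV[R]_d with its Borel sigma-algebra. *)
Definition rV_borel_display (R : realType) (d : nat) : measure_display :=
  sigma_display (@open 'rV[R]_d).

Section rV_borel.
Variables (R : realType) (d : nat).

Let borel0 : <<s @open 'rV[R]_d >> set0.
Proof. exact: sigma_algebra0. Qed.

Let borelC A : <<s @open 'rV[R]_d >> A -> <<s @open 'rV[R]_d >> (~` A).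
Proof. exact: sigma_algebraC. Qed.

Let borelU (F : (set 'rV[R]_d)^nat) :
  (forall i, <<s @open 'rV[R]_d >> (F i)) ->
  <<s @open 'rV[R]_d >> (\bigcup_i F i).
Proof. exact: sigma_algebra_bigcup. Qed.

HB.instance Definition _ := @isMeasurable.Build (rV_borel_display R d)
  'rV[R]_d <<s @open 'rV[R]_d >> borel0 borelC borelU.

End rV_borel.

Section euclidean.
Variables (R : realType) (d : nat).
Implicit Types x y : 'rV[R]_d.

Definition dot x y : R := \sum_(i < d) x 0 i * y 0 i.

(* The library norm `|x| on 'rV[R]_d is the sup norm. *)
Definition enorm x : R := Num.sqrt (dot x x).

Definition orthant : set 'rV[R]_d := [set s | forall i, 0 <= s 0 i].

End euclidean.
Arguments orthant {R d}.

Section complex_valued.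
Variable R : realType.

Definition cexp (z : R[i]) : R[i] :=
  (expR (complex.Re z) * cos (complex.Im z)) +i*
  (expR (complex.Re z) * sin (complex.Im z)).

(* Principal argument, in ]-pi, pi]. *)
Definition carg (z : R[i]) : R :=
  let a := acos (complex.Re z / ComplexField.Normc.normc z) in
  if 0 <= complex.Im z then a else - a.

Definition clog (z : R[i]) : R[i] :=
  ln (ComplexField.Normc.normc z) +i* carg z.

Definition is_log (w z : R[i]) : Prop := cexp w = z.

Context {disp : measure_display} {T : measurableType disp}.
Variables (mu : {measure set T -> \bar R}) (D : set T) (g : T -> R[i]).

Definition cintegrable : Prop :=
  mu.-integrable D (fun x => (complex.Re (g x))%:E) /\
  mu.-integrable D (fun x => (complex.Im (g x))%:E).

Definition cintegral : R[i] :=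
  (\int[mu]_(x in D) complex.Re (g x)) +i* (\int[mu]_(x in D) complex.Im (g x)).

End complex_valued.

Section thorin.
Variables (R : realType) (d : nat).
Variable nu : {measure set 'rV[R]_d -> \bar R}.
Local Open Scope ereal_scope.

Definition radon : Prop :=
  (forall K, compact K -> nu K < +oo) /\
  (forall A, measurable A ->
    nu A = ereal_sup [set nu K | K in [set K | compact K /\ K `<=` A]]).

(* A measure on the orthant is a measure on R^d that does not charge the
   complement of the orthant. Since lne 0 = -oo, the first integral condition
   forces nu [set 0] = 0. *)
Definition thorin_measure : Prop :=
  [/\ radon,
      nu (~` orthant) = 0,
      \int[nu]_(s in orthant `&` [set s | (enorm s <= 1)%R])
        `|lne (enorm s)%:E| < +oo &
      \int[nu]_(s in orthant `&` [set s | (1 < enorm s)%R])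
        ((enorm s)^-1)%:E < +oo].

End thorin.

Section mggc.
Context {disp : measure_display} {O : measurableType disp} {R : realType}.
Context {d : nat} (P : probability O R) (X : {RV P >-> 'rV[R]_d}).
Variable nu : {measure set 'rV[R]_d -> \bar R}.

Definition char_fun (t : 'rV[R]_d) : R[i] :=
  cintegral P setT (fun w => cexp ('i * (dot t (X w))%:C)).

(* The principal branch is used under the integral only: for large t the
   imaginary part of the integral may leave ]-pi, pi], so that the equation
   for log (char_fun t) says that the right-hand side is a logarithm of
   char_fun t, namely the one that is continuous in t and vanishes at 0. *)
Definition mggc : Prop :=
  (forall w, orthant (X w)) /\
  forall t : 'rV[R]_d,
    let g s := clog (1 - 'i * (dot s t)%:C) in
    cintegrable nu orthant g /\
    is_log (- cintegral nu orthant g) (char_fun t).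

End mggc.

Section stein.
Context {disp : measure_display} {O : measurableType disp} {R : realType}.
Context {d : nat} (P : probability O R) (X : {RV P >-> 'rV[R]_d}).
Variable nu : {measure set 'rV[R]_d -> \bar R}.
Implicit Types (f : 'rV[R]_d -> 'rV[R]_d) (x : 'rV[R]_d).

Definition stein_class : set ('rV[R]_d -> 'rV[R]_d) := [set f |
  [/\ measurable_fun setT f,
      ('E_P[(fun w => `|dot (X w) (f (X w))|)%R] < +oo)%E &
      (\int[nu]_(s in orthant) \int[lebesgue_measure]_(z in `[0%R, +oo[)
        ((expR (- z))%:E * 'E_P[(fun w => `|dot s (f (X w + z *: s))|)%R])
        < +oo)%E]].

Definition stein_dom f : set 'rV[R]_d := [set x |
  (\int[nu]_(s in orthant) \int[lebesgue_measure]_(z in `[0%R, +oo[)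
    (expR (- z) * `|dot s (f (x + z *: s))|)%:E < +oo)%E].

(* Only the values at points of stein_dom f are meaningful. *)
Definition stein_op f x : R :=
  dot x (f x) - \int[nu]_(s in orthant) \int[lebesgue_measure]_(z in `[0, +oo[)
    (expR (- z) * dot s (f (x + z *: s))).

Definition stein_op_rv {disp' : measure_display} {O' : measurableType disp'}
    (P' : probability O' R) (E : {RV P' >-> R}) f x : R :=
  dot x (f x) -
  \int[nu]_(s in orthant) fine ('E_P'[(fun w => dot s (f (x + E w *: s)))%R])%E.

(* T f is meaningful on dom f only. *)
Definition stein_operator (F : set ('rV[R]_d -> 'rV[R]_d))
    (dom : ('rV[R]_d -> 'rV[R]_d) -> set 'rV[R]_d)
    (T : ('rV[R]_d -> 'rV[R]_d) -> 'rV[R]_d -> R) : Prop :=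
  forall f, F f ->
    [/\ {ae P, forall w, dom f (X w)},
        P.-integrable setT (fun w => (T f (X w))%:E) &
        ('E_P[(fun w => T f (X w))%R] = 0)%E].

End stein.

(* Equality of laws is tested on measurable sets only, since the values of a
   library measure on other sets carry no information. *)
Definition exp1_distributed {disp : measure_display} {O : measurableType disp}
    {R : realType} (P : probability O R) (E : {RV P >-> R}) : Prop :=
  forall A : set R, measurable A ->
    distribution P E A = exponential_prob (1 : R) A.

(* Main.v *)
Require Import Defs.
From HB Require Import structures.
From mathcomp Require Import all_boot all_order all_algebra.
From mathcomp Require Import complex ring lra.
From mathcomp Require Import all_classical all_reals all_analysis.
From mathcomp Require Import measurable_realfun.

Set Implicit Arguments.
Unset Strict Implicit.
Unset Printing Implicit Defensive.

Import Order.TTheory GRing.Theory Num.Theory.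
Import numFieldNormedType.Exports.

Local Open Scope classical_set_scope.
Local Open Scope ring_scope.

(** The identity says that two finite vector measures agree. For a coordinate j
    put mu_j (B) = E [X_j 1_B (X)] and let eta_j (B) be the integral of
    s_j e^(-z) P (X + z s \in B) over z >= 0 and nu (ds): the identity for bounded f
    is the sum over j of the equalities between the integrals of f_j against mu_j
    and eta_j, so that mu_j = eta_j is what has to be proved, and this follows from
    the equality of their Fourier transforms.

    The Fourier transforms agree because of the form of the characteristic function.
    Taking real and imaginary parts of the logarithm,
      E [cos (<t, X> + a)] = e^(- A t) cos (B t + a),
    where A t is the integral of log (1 + <s, t>^2) / 2 and B t that of atan <s, t>
    (mggc_cosE). Both sides, with a - pi / 2 for a, are differentiated in the direction
    of the j-th basis vector. On the left this produces E [X_j cos (<t, X> + a)]; on the right it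
    produces the integrals of s_j <s, t> / (1 + <s, t>^2) and s_j / (1 + <s, t>^2)
    (mggc_size_bias_cos). As 1 / (1 + u^2) and u / (1 + u^2) are the integrals of
    e^(-z) cos (z u) and e^(-z) sin (z u) (Rintegral_exp_cos), the right-hand side is
    the Fourier transform of eta_j (size_bias_cos). The integrability of |s| makes the
    differentiation under nu legitimate; the one under E needs E [X_j] < oo, which
    is derived from the same formulas (mggc_coord_integrable).

    A finite signed measure whose Fourier transform vanishes is zero. This is proved
    for functionals on bounded Borel functions (bounded_functional_eq0), without
    Gaussian kernels or inversion: the functions h such that multiplication by h
    preserves the property of having integral 0 against all trigonometric functions
    form an algebra which is closed under bounded pointwise limits. It contains the
    trigonometric functions, hence the indicators of half-spaces, hence all bounded
    Borel functions.

    For f in the Stein class only the scalar products <X, f (X)> and <s, f (X + z s)>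
    are integrable, and their single terms need not be. The passage from bounded
    to general f therefore truncates f as a vector, which keeps both scalar products
    under their absolute values, and concludes by dominated convergence
    (size_bias_dot). The remaining statements are obtained from Fubini's theorem on
    the product of nu, the exponential law and the law of the sample point. *)

(** * Calculus on the real line *)

Section real_calculus.
Context {R : realType}.
Implicit Types u v : R.

Lemma one_sqr_gt0 u : 0 < 1 + u ^+ 2.
Proof. by rewrite ltr_wpDr ?sqr_ge0. Qed.

Lemma measurable_inv_one_sqr : measurable_fun setT (fun u : R => (1 + u ^+ 2)^-1).
Proof.
apply: continuous_measurable_fun => u; apply: cvgV.
  by apply: lt0r_neq0; exact: one_sqr_gt0.
apply: cvgD; first exact: cvg_cst.
by apply: cvgM; exact: cvg_id.
Qed.

Lemma is_derive_half_ln1D u :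
  is_derive u 1 (fun u => 2^-1 * ln (1 + u ^+ 2)) (u / (1 + u ^+ 2)).
Proof.
have u1 := one_sqr_gt0 u.
have dq : is_derive u 1 (fun u => 1 + u ^+ 2) (2 * u).
  by apply: is_derive_eq; rewrite /GRing.scale /=; ring.
have dl := @is_derive1_comp _ (@ln R) (fun u => 1 + u ^+ 2) _ _ _ (is_derive1_ln u1) dq.
apply: (is_derive_eq (is_deriveZ _ dl)).
by rewrite /GRing.scale /=; field; rewrite gt_eqF.
Qed.

Lemma abs_poisson_le1 u : `|u / (1 + u ^+ 2)| <= 1.
Proof.
rewrite normrM normfV (gtr0_norm (one_sqr_gt0 u)) ler_pdivrMr ?one_sqr_gt0// mul1r.
have := sqr_ge0 (`|u| - 1); rewrite -[u ^+ 2]real_normK ?num_real//; nra.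
Qed.

Lemma abs_inv_one_sqr_le1 u : `|(1 + u ^+ 2)^-1| <= 1.
Proof.
rewrite normfV gtr0_norm ?one_sqr_gt0// invf_le1 ?one_sqr_gt0//.
by rewrite lerDl sqr_ge0.
Qed.

Lemma abs_le_of_abs_derive_le1 (f f' : R -> R) u :
  (forall x : R, is_derive x 1 f (f' x)) -> (forall x, `|f' x| <= 1) ->
  f 0 = 0 -> `|f u| <= `|u|.
Proof.
move=> df f'1 f0.
have cf (i : interval R) : {within [set` i], continuous f}.
  by apply: derivable_within_continuous => x _; exact: ex_derive.
have [u0|u0|->] := ltgtP u 0; last by rewrite f0.
- have [c _] := MVT u0 (fun x _ => df x) (cf _).
  rewrite f0 !sub0r => /(congr1 Num.norm); rewrite normrN normrM normrN => ->.
  by rewrite ler_piMl.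
- have [c _] := MVT u0 (fun x _ => df x) (cf _).
  by rewrite f0 !subr0 => ->; rewrite normrM ler_piMl.
Qed.

Lemma abs_atan_le u : `|atan u| <= `|u|.
Proof.
apply: (@abs_le_of_abs_derive_le1 (@atan R) (fun x => (1 + x ^+ 2)^-1)).
- exact: abs_inv_one_sqr_le1.
- exact: atan0.
Qed.

Lemma abs_sin_le u : `|sin u| <= `|u|.
Proof.
apply: (@abs_le_of_abs_derive_le1 (@sin R) cos); last exact: sin0.
by move=> x; rewrite ler_norml cos_geN1 cos_le1.
Qed.

Lemma series_exp_coeff_le (x : R) n : 0 <= x -> series (exp_coeff x) n <= expR x.
Proof.
move=> x0; apply: nondecreasing_cvgn_le; last exact: is_cvg_series_exp_coeff.
by apply: nondecreasing_series => k _ _; exact: exp_coeff_ge0.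
Qed.

(** A sequence of entire functions of s, with values in [0, 1], that converges
    everywhere to the indicator of the negative half-line. The term n in the
    exponent decides the case s = 0. *)
Lemma cvg_double_exp (s : R) :
  expR (- expR (n%:R ^+ 2 * s + n%:R)) @[n --> \oo] -->
  ((s < 0)%R%:R : R).
Proof.
have eN0 : expR (- n%:R) @[n --> \oo] --> (0 : R) by exact: cvgn_expR.
have [s0|s0] := ltP s 0; last first.
  apply: (squeeze_cvgr _ (cvg_cst 0) eN0).
  apply: nearW => n; rewrite expR_ge0 ler_expR lerN2.
  apply: (@le_trans _ _ (1 + (n%:R ^+ 2 * s + n%:R))); last exact: expR_ge1Dx.
  have : 0 <= n%:R ^+ 2 * s by rewrite mulr_ge0.
  by lra.
have u0 : expR (n%:R ^+ 2 * s + n%:R) @[n --> \oo] --> (0 : R).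
  apply: (squeeze_cvgr _ (cvg_cst 0) eN0).
  (* once n |s| >= 2, the exponent n (n s + 1) is at most - n *)
  near=> n; rewrite expR_ge0 ler_expR /=.
  have : 2 / - s <= n%:R by near: n; exact: nbhs_infty_ger.
  rewrite ler_pdivrMr ?oppr_gt0// => ns.
  have : n%:R * (n%:R * s) <= n%:R * (- 2) by apply: ler_wpM2l => //; lra.
  by rewrite expr2; lra.
rewrite /= -[X in _ --> X](@expR0 R) -oppr0.
apply: (@continuous_cvg _ _ _ _ _ _ expR); first exact: continuous_expR.
exact: cvgN.
Unshelve. all: by end_near. Qed.

(** The sine is periodic, but at a slow enough frequency it has the sign of its
    argument. *)
Lemma near_sin_lt0 (y : R) : \forall n \near \oo, (sin (n.+1%:R^-1 * y) < 0) = (y < 0).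
Proof.
near=> n.
have n0 : (0 : R) < n.+1%:R^-1 by rewrite invr_gt0.
have yn : `|n.+1%:R^-1 * y| < pi.
  rewrite normrM gtr0_norm// mulrC ltr_pdivrMr// -ltr_pdivrMl ?pi_gt0//.
  rewrite (@lt_trans _ _ n%:R) ?ltr_nat//.
  by near: n; exact: nbhs_infty_gtr.
move: yn; rewrite ltr_norml => /andP[y1 y2].
have [ylt|ygt|->] := ltgtP y 0.
- rewrite -oppr_gt0 -sinN sin_gt0_pi//.
  by rewrite ltrNl y1 andbT oppr_gt0 pmulr_rlt0.
- by apply/negbTE; rewrite -leNgt ltW// sin_gt0_pi// y2 pmulr_rgt0// ygt.
- by rewrite mulr0 sin0 ltxx.
Unshelve. all: by end_near. Qed.

End real_calculus.

Section probability_bounded.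
Context {dT} {T : measurableType dT} {R : realType} (P : probability T R).

Lemma bounded_integrable (h : T -> R) M : measurable_fun setT h ->
  (forall w, `|h w| <= M) -> P.-integrable setT (EFin \o h).
Proof.
move=> mh hM; apply: measurable_bounded_integrable => //.
  by rewrite (le_lt_trans (probability_le1 _ _))// ltry.
by exists M; split; [exact: num_real|move=> x Mx z _; exact: le_trans (hM z) (ltW _)].
Qed.

Lemma measurable_cosD (p : T -> R) a : measurable_fun setT p ->
  measurable_fun setT (fun w => cos (p w + a)).
Proof.
move=> mp; apply: (@measurableT_comp _ _ _ _ _ _ cos).
  by apply: continuous_measurable_fun; exact: continuous_cos.
exact: measurable_funD.
Qed.

Lemma integrable_cos (p : T -> R) a : measurable_fun setT p ->
  P.-integrable setT (EFin \o (fun w => cos (p w + a))).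
Proof.
move=> mp; apply: (bounded_integrable (M := 1)); first exact: measurable_cosD.
by move=> w; rewrite ler_norml cos_geN1 cos_le1.
Qed.

End probability_bounded.

(** * Borel sets of row vectors *)

Section borel.
Context {R : realType} {d : nat}.

Definition rational_box (p : 'rV[rat]_d * 'rV[rat]_d) : set 'rV[R]_d :=
  [set x | forall i, ratr (p.1 0 i) < x 0 i < ratr (p.2 0 i)].

Lemma open_rational_boxE (U : set 'rV[R]_d) : open U ->
  U = \bigcup_(p in [set p | rational_box p `<=` U]) rational_box p.
Proof.
move=> oU; apply/seteqP; split => [x Ux|x [p /= pU]]; last exact: pU.
have /nbhs_ballP[e /= e0 eU] : nbhs x U by rewrite nbhsE; exists U.
have a_ i : exists q : rat, ratr q \in `]x 0 i - e, x 0 i[.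
  by apply: rat_in_itvoo; rewrite gtrBl.
have b_ i : exists q : rat, ratr q \in `]x 0 i, x 0 i + e[.
  by apply: rat_in_itvoo; rewrite ltrDl.
have [a Pa] := choice a_; have [b Pb] := choice b_.
exists (\row_i a i, \row_i b i) => /=.
  move=> y /= xy; apply: eU; split => // k i; rewrite (ord1 k).
  move: (xy i) (Pa i) (Pb i); rewrite !mxE !in_itv /=.
  move=> /andP[? ?] /andP[? ?] /andP[? ?].
  by rewrite /ball /= ltr_norml; apply/andP; split; lra.
move=> i; rewrite !mxE.
by move: (Pa i) (Pb i); rewrite !in_itv/= => /andP[_ ->] /andP[->].
Qed.

Definition coord_halfspaces : set (set 'rV[R]_d) :=
  [set A | exists (i : 'I_d) (a : R), A = [set x : 'rV[R]_d | x 0 i < a]].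

Lemma borel_rV_generated :
  @measurable _ 'rV[R]_d `<=` <<s coord_halfspaces >>.
Proof.
apply: smallest_sub; first exact: smallest_sigma_algebra.
move=> U oU; rewrite (open_rational_boxE oU) bigcup_mkcond.
apply: (@countable_bigcupT_measurable _ (g_sigma_algebraType coord_halfspaces)).
  exact: countableP.
move=> p; case: ifPn => _; last exact: measurable0.
suff : @measurable _ (g_sigma_algebraType coord_halfspaces) (rational_box p).
  by [].
have -> : rational_box p = \big[setI/setT]_(i < d)
    ([set x : 'rV[R]_d | x 0 i < ratr (p.2 0 i)] `&`
     [set x : 'rV[R]_d | ratr (p.1 0 i) < x 0 i]).
  apply/seteqP; split => [x xp|x].
    by elim/big_ind: _ => // i _; have /andP[? ?] := xp i; split.
  rewrite -bigcap_seq => xp i.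
  by have [] := xp i (mem_index_enum i) => /= -> ->.
apply: bigsetI_measurable => i _.
apply: measurableI.
  by apply: sub_sigma_algebra; exists i, (ratr (p.2 0 i)).
have -> : [set x : 'rV[R]_d | ratr (p.1 0 i) < x 0 i] =
    \bigcup_n ~` [set x : 'rV[R]_d | x 0 i < ratr (p.1 0 i) + n.+1%:R^-1].
  apply/seteqP; split => [x /= px|x [n _] /=].
    have xp : 0 < x 0 i - ratr (p.1 0 i) by rewrite subr_gt0.
    have [n _ nP] := near_infty_natSinv_lt (PosNum xp).
    exists n => //=; apply/negP; rewrite -leNgt -lerBrDl ltW//.
    by have := nP n (leqnn n); rewrite /=.
  by move/negP; rewrite -leNgt; apply: lt_le_trans; rewrite ltrDl.
apply: bigcupT_measurable => n; apply: measurableC.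
by apply: sub_sigma_algebra; exists i, (ratr (p.1 0 i) + n.+1%:R^-1).
Qed.

(** Coordinate half-spaces generate the Borel sets; this form serves both for the
    measurability of maps into row vectors and for the indicators that are obtained
    as limits of trigonometric functions. *)
Lemma borel_rV_min (G : set (set 'rV[R]_d)) : sigma_algebra setT G ->
  (forall i a, G [set x : 'rV[R]_d | x 0 i < a]) -> @measurable _ 'rV[R]_d `<=` G.
Proof.
move=> sG Gi; apply: (subset_trans borel_rV_generated).
by apply: smallest_sub => // _ [i [a ->]].
Qed.

Lemma measurable_coord i : measurable_fun setT (fun x : 'rV[R]_d => x 0 i).
Proof.
apply: (measurability _ (RGenInftyO.measurableE R)) => _ [_ [a ->] <-].
rewrite setTI; apply: sub_sigma_algebra; apply: open_comp.
  by move=> x _; exact: coord_continuous.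
exact: lray_open.
Qed.

Lemma measurable_rV dT (T : measurableType dT) (f : T -> 'rV[R]_d) :
  (forall i, measurable_fun setT (fun x => f x 0 i)) -> measurable_fun setT f.
Proof.
move=> mf _ A mA; rewrite setTI; move: A mA.
apply: (@borel_rV_min [set A | measurable (f @^-1` A)]).
  split=> [|A /= mA|F /= mF].
  - by rewrite /= preimage_set0.
  - by rewrite setTD -preimage_setC; apply: measurableC.
  - by rewrite preimage_bigcup; exact: bigcupT_measurable.
move=> i a /=.
have := mf i measurableT _ (measurable_itv `]-oo, a[).
by rewrite setTI; congr (measurable _); apply/seteqP; split => x; rewrite /= in_itv.
Qed.

Lemma measurable_coord_box (A : set R) : measurable A ->
  measurable [set s : 'rV[R]_d | forall i, A (s 0 i)].
Proof.
move=> mA; rewrite [X in measurable X](_ : _ =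
    \big[setI/setT]_(i < d) ((fun s : 'rV[R]_d => s 0 i) @^-1` A)).
  apply: bigsetI_measurable => i _; rewrite -[X in measurable X]setTI.
  exact: (measurable_coord i).
apply/seteqP; split => [s s0|s].
  by elim/big_ind: _ => // i _; exact: s0.
by rewrite -bigcap_seq => s0 i; exact: (s0 i (mem_index_enum i)).
Qed.

End borel.

Section dot_theory.
Context {R : realType} {d : nat}.
Implicit Types x y : 'rV[R]_d.

Lemma dotDr t x y : dot t (x + y) = dot t x + dot t y.
Proof. by rewrite -big_split; apply: eq_bigr => i _; rewrite mxE mulrDr. Qed.

Lemma dotZr t c x : dot t (c *: x) = c * dot t x.
Proof. by rewrite /dot mulr_sumr; apply: eq_bigr => i _; rewrite mxE mulrCA. Qed.

Lemma dotC x y : dot x y = dot y x.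
Proof. by apply: eq_bigr => i _; rewrite mulrC. Qed.

Lemma dotDl x y z : dot (x + y) z = dot x z + dot y z.
Proof. by rewrite dotC dotDr !(dotC z). Qed.

Lemma dotZl c x z : dot (c *: x) z = c * dot x z.
Proof. by rewrite dotC dotZr dotC. Qed.

Lemma dot_delta j x : dot (delta_mx 0 j) x = x 0 j.
Proof.
rewrite /dot (bigD1 j)//= mxE !eqxx mul1r big1 ?addr0// => i ij.
by rewrite mxE (negbTE ij) andbF mul0r.
Qed.

Lemma measurable_dot {dT} {T : measurableType dT} (f g : T -> 'rV[R]_d) :
  measurable_fun setT f -> measurable_fun setT g ->
  measurable_fun setT (fun w => dot (f w) (g w)).
Proof.
move=> mf mg; apply: measurable_sum => i; apply: measurable_funM.
  exact: measurableT_comp (measurable_coord i) mf.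
exact: measurableT_comp (measurable_coord i) mg.
Qed.

End dot_theory.

(** * Uniqueness for Fourier transforms *)

Section fourier_uniqueness.
Context {R : realType} {d : nat}.
Notation V := ('rV[R]_d).

Definition bounded_borel (h : V -> R) :=
  measurable_fun setT h /\ exists M, forall x, `|h x| <= M.

(** The functionals that integration against a finite signed measure defines. *)
Definition bounded_functional (Lam : (V -> R) -> R) :=
  [/\ forall g h, bounded_borel g -> bounded_borel h ->
        Lam (fun x => g x + h x) = Lam g + Lam h,
      forall c g, bounded_borel g -> Lam (fun x => c * g x) = c * Lam g &
      forall (h_ : nat -> V -> R) h M,
        (forall n, measurable_fun setT (h_ n)) ->
        (forall n x, `|h_ n x| <= M) ->
        (forall x, h_ n x @[n --> \oo] --> h x) ->
        Lam (h_ n) @[n --> \oo] --> Lam h].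

Lemma bounded_borel_cst c : bounded_borel (fun=> c).
Proof. by split; [exact: measurable_cst|exists `|c|]. Qed.

Lemma bounded_borelD g h : bounded_borel g -> bounded_borel h ->
  bounded_borel (fun x => g x + h x).
Proof.
move=> [mg [M gM]] [mh [N hN]]; split; first exact: measurable_funD.
by exists (M + N) => x; rewrite (le_trans (ler_normD _ _))// lerD.
Qed.

Lemma bounded_borelM g h : bounded_borel g -> bounded_borel h ->
  bounded_borel (fun x => g x * h x).
Proof.
move=> [mg [M gM]] [mh [N hN]]; split; first exact: measurable_funM.
by exists (M * N) => x; rewrite normrM ler_pM.
Qed.

Lemma measurable_cos_dot t a : measurable_fun setT (fun x : V => cos (dot t x + a)).
Proof. by apply: measurable_cosD; exact: measurable_dot. Qed.

Lemma bounded_borel_cos t a : bounded_borel (fun x => cos (dot t x + a)).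
Proof.
by split; [exact: measurable_cos_dot|exists 1 => x; rewrite ler_norml cos_geN1 cos_le1].
Qed.

Lemma bounded_borel_cvg (h_ : nat -> V -> R) h M :
  (forall n, measurable_fun setT (h_ n)) ->
  (forall n x, `|h_ n x| <= M) ->
  (forall x, h_ n x @[n --> \oo] --> h x) -> bounded_borel h.
Proof.
move=> mh hM hh; split.
  by apply: (measurable_fun_cvg mh) => x _; exact: hh.
exists M => x; have /cvg_norm hx := hh x.
rewrite -(cvg_lim _ hx)//; apply: limr_le; first exact: cvgP hx.
by apply: nearW => n.
Qed.

Lemma bounded_functionalB (L1 L2 : ('rV[R]_d -> R) -> R) :
  bounded_functional L1 -> bounded_functional L2 ->
  bounded_functional (fun h => L1 h - L2 h).
Proof.
move=> [D1 Z1 C1] [D2 Z2 C2]; split=> [f h bf bh|c f bf|h_ h M mh hM hh].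
- by rewrite D1// D2//; ring.
- by rewrite Z1// Z2//; ring.
- by apply: cvgB; [exact: C1 mh hM hh|exact: C2 mh hM hh].
Qed.

Variable Lam : (V -> R) -> R.
Hypothesis LamP : bounded_functional Lam.

Let LamD g h : bounded_borel g -> bounded_borel h ->
  Lam (fun x => g x + h x) = Lam g + Lam h.
Proof. by case: LamP => + _ _; apply. Qed.

Let LamZ c g : bounded_borel g -> Lam (fun x => c * g x) = c * Lam g.
Proof. by case: LamP => _ + _; apply. Qed.

Definition trig_null g :=
  bounded_borel g /\ forall t a, Lam (fun x => g x * cos (dot t x + a)) = 0.

(** Multipliers, rather than the null functions themselves, are closed under products,
    and this gives access to polynomials and exponentials of trigonometric functions. *)
Definition trig_multiplier h :=
  bounded_borel h /\ forall g, trig_null g -> trig_null (fun x => h x * g x).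

Lemma multiplier_cst c : trig_multiplier (fun=> c).
Proof.
split=> [|g [bg g0]]; first exact: bounded_borel_cst.
split=> [|t a]; first by apply: bounded_borelM => //; exact: bounded_borel_cst.
under eq_fun do rewrite -mulrA.
rewrite LamZ ?g0 ?mulr0//; apply: bounded_borelM => //.
exact: bounded_borel_cos.
Qed.

Lemma multiplierD g h : trig_multiplier g -> trig_multiplier h ->
  trig_multiplier (fun x => g x + h x).
Proof.
move=> [bg Qg] [bh Qh]; split=> [|f f0]; first exact: bounded_borelD.
have [bgf gf0] := Qg _ f0; have [bhf hf0] := Qh _ f0.
split=> [|t a].
  by apply: bounded_borelM; [exact: bounded_borelD|case: f0].
under eq_fun do rewrite !mulrDl.
by rewrite LamD ?gf0 ?hf0 ?addr0//;
  apply: bounded_borelM => //; exact: bounded_borel_cos.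
Qed.

Lemma multiplierM g h : trig_multiplier g -> trig_multiplier h ->
  trig_multiplier (fun x => g x * h x).
Proof.
move=> [bg Qg] [bh Qh]; split=> [|f f0]; first exact: bounded_borelM.
by under eq_fun do rewrite -mulrA; apply/Qg/Qh.
Qed.

Lemma multiplier_sum (I : Type) (r : seq I) (h : I -> V -> R) :
  (forall i, trig_multiplier (h i)) ->
  trig_multiplier (fun x => \sum_(i <- r) h i x).
Proof.
move=> Qh; elim: r => [|i r IH].
  by under eq_fun do rewrite big_nil; exact: multiplier_cst.
by under eq_fun do rewrite big_cons; exact: multiplierD.
Qed.

Lemma multiplierX h n : trig_multiplier h -> trig_multiplier (fun x => h x ^+ n).
Proof.
move=> Qh; elim: n => [|n IH].
  by under eq_fun do rewrite expr0; exact: multiplier_cst.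
by under eq_fun do rewrite exprS; exact: multiplierM.
Qed.

Lemma multiplier_cvg (h_ : nat -> V -> R) h M :
  (forall n, trig_multiplier (h_ n)) ->
  (forall n x, `|h_ n x| <= M) ->
  (forall x, h_ n x @[n --> \oo] --> h x) -> trig_multiplier h.
Proof.
move=> Qh hM hh.
have bh : bounded_borel h by apply: bounded_borel_cvg hM hh => n; case: (Qh n) => -[].
split=> // g g0; have [[mg [N gN]] _] := g0.
split=> [|t a]; first by apply: bounded_borelM => //; case: g0.
have : Lam (fun x => h_ n x * g x * cos (dot t x + a)) @[n --> \oo] -->
    Lam (fun x => h x * g x * cos (dot t x + a)).
  have [_ _ Lam_cvg] := LamP; apply: (Lam_cvg _ _ (M * N)) => [n|n x|x].
  - apply: measurable_funM; last exact: measurable_cos_dot.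
    by apply: measurable_funM => //; case: (Qh n) => -[].
  - rewrite !normrM -[leRHS]mulr1 ler_pM ?mulr_ge0//.
      by rewrite ler_pM ?hM ?gN.
    by rewrite ler_norml cos_geN1 cos_le1.
  - by apply: cvgMl; apply: cvgMl; exact: hh.
under eq_fun do rewrite ((Qh _).2 _ g0).2.
by move/cvg_lim => <- //; rewrite lim_cst.
Qed.

(** The product of two cosines is half the sum of two cosines. *)
Lemma multiplier_cos t a : trig_multiplier (fun x => cos (dot t x + a)).
Proof.
split=> [|g [bg g0]]; first exact: bounded_borel_cos.
split=> [|u b]; first by apply: bounded_borelM => //; exact: bounded_borel_cos.
have -> : (fun x => cos (dot t x + a) * g x * cos (dot u x + b)) =
  (fun x => 2^-1 * (g x * cos (dot (t + u) x + (a + b)) +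
                    g x * cos (dot (t + (- 1) *: u) x + (a - b)))).
  apply/funext => x; rewrite !dotDl dotZl mulN1r.
  rewrite (_ : _ + (a + b) = (dot t x + a) + (dot u x + b)); last ring.
  rewrite (_ : _ + (a - b) = (dot t x + a) - (dot u x + b)); last ring.
  move: (dot t x + a) (dot u x + b) => A B.
  by rewrite cosD cosB; field.
rewrite LamZ ?LamD ?g0 ?addr0 ?mulr0//; last first.
  by apply: bounded_borelD; apply: bounded_borelM => //; exact: bounded_borel_cos.
all: by apply: bounded_borelM => //; exact: bounded_borel_cos.
Qed.

Lemma multiplier_sin t a : trig_multiplier (fun x => sin (dot t x + a)).
Proof.
have -> : (fun x => sin (dot t x + a)) = (fun x => cos (dot t x + (a - pi / 2))).
  by apply/funext => x; rewrite addrA cosBpihalf.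
exact: multiplier_cos.
Qed.

(** The partial sums of the exponential series of h are bounded by exp (sup |h|). *)
Lemma multiplier_expR h : trig_multiplier h -> trig_multiplier (fun x => expR (h x)).
Proof.
move=> Qh; have [[_ [M hM]] _] := Qh.
apply: (@multiplier_cvg (fun n x => series (exp_coeff (h x)) n) _ (expR M)).
- move=> n; rewrite /series/=; apply: multiplier_sum => k.
  under eq_fun do rewrite /exp_coeff.
  apply: multiplierM; last exact: multiplier_cst.
  exact: multiplierX.
- move=> n x; rewrite (le_trans (ler_norm_sum _ _ _))//.
  rewrite (le_trans _ (@series_exp_coeff_le _ M n (le_trans _ (hM x))))//.
  apply: ler_sum => k _; rewrite /exp_coeff normrM normrX.
  by rewrite ler_pM ?exprn_ge0// ?lerXn2r ?nnegrE// ?ger0_norm// (le_trans _ (hM x)).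
- by move=> x; exact: is_cvg_series_exp_coeff.
Qed.

Lemma multiplier_neg h : trig_multiplier h ->
  trig_multiplier (fun x => (h x < 0)%R%:R : R).
Proof.
move=> Qh.
apply: (@multiplier_cvg (fun n x => expR (- expR (n%:R ^+ 2 * h x + n%:R))) _ 1).
- move=> n; apply: multiplier_expR.
  under eq_fun do rewrite -mulN1r.
  apply: multiplierM; first exact: multiplier_cst.
  apply: multiplier_expR; apply: multiplierD; last exact: multiplier_cst.
  by apply: multiplierM => //; exact: multiplier_cst.
- by move=> n x; rewrite ger0_norm ?expR_ge0.
- by move=> x; exact: cvg_double_exp.
Qed.

Lemma multiplier_halfspace i a : trig_multiplier (fun x : V => (x 0 i < a)%R%:R : R).
Proof.
apply: (@multiplier_cvg
  (fun n x =>
    (sin (dot (n.+1%:R^-1 *: delta_mx 0 i) x - n.+1%:R^-1 * a) < 0)%R%:R : R) _ 1).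
- by move=> n; apply: multiplier_neg; exact: multiplier_sin.
- by move=> n x; rewrite normr_nat; case: ltP.
- move=> x; apply: cvg_near_cst; rewrite -subr_lt0.
  have := near_sin_lt0 (x 0 i - a); apply: filterS => n <-.
  by rewrite dotZl dot_delta mulrBr.
Qed.

(** The sets with this property form a sigma-algebra: complements come from
    the constants, intersections from the products, countable unions from the bounded
    limits. *)
Lemma multiplier_indic (A : set V) : measurable A ->
  trig_multiplier (fun x : V => (x \in A)%:R : R).
Proof.
move: A; suff : @measurable _ V `<=`
    [set A : set V | trig_multiplier (fun x : V => (x \in A)%:R : R)].
  exact.
apply: (@borel_rV_min _ _ [set A : set V | trig_multiplier (fun x : V => (x \in A)%:R : R)]).
  have QC B : trig_multiplier (fun x : V => (x \in B)%:R : R) ->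
      trig_multiplier (fun x : V => (x \in ~` B)%:R : R).
    move=> QB; rewrite [X in trig_multiplier X](_ : _ =
        (fun x => 1 + (- 1) * (x \in B)%:R)).
      apply: multiplierD; first exact: multiplier_cst.
      by apply: multiplierM => //; exact: multiplier_cst.
    by apply/funext => x; rewrite in_setC; case: (x \in B); rewrite /=; ring.
  split => [|B /=|F /= QF].
  - by rewrite /=; under eq_fun do rewrite in_set0; exact: multiplier_cst.
  - by rewrite setTD; exact: QC.
  - have QU n : trig_multiplier (fun x : V => (x \in \bigcup_(i < n) F i)%:R : R).
      elim: n => [|n IH].
        rewrite bigcup_mkord big_ord0.
        by under eq_fun do rewrite in_set0; exact: multiplier_cst.
      rewrite bigcup_mkord big_ord_recr /= -bigcup_mkord -[X in X `|` _]setCK.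
      rewrite -[X in _ `|` X]setCK -setCI; apply: (QC).
      under eq_fun do rewrite in_setI -mulnb natrM.
      by apply: multiplierM; exact: QC.
    apply: (multiplier_cvg QU (M := 1)).
      by move=> n x; rewrite normr_nat; case: (_ \in _).
    move=> x; apply: cvg_near_cst.
    have [[k _ Fkx]|nFx] := pselect ((\bigcup_i F i) x).
      exists k.+1 => // n /= kn; rewrite !mem_set//; first by exists k.
      by exists k.
    near=> n; rewrite !memNset//; apply: contra_not nFx => -[k _ Fkx].
    by exists k.
move=> i a /=; have := multiplier_halfspace i a.
congr trig_multiplier; apply/funext => x; congr (nat_of_bool _)%:R.
by apply/idP/idP; rewrite inE.
Unshelve. all: by end_near. Qed.

Import HBNNSimple.

Lemma multiplier_bounded_borel h : bounded_borel h -> trig_multiplier h.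
Proof.
move=> [mh [M hM]].
have hM0 x : 0 <= h x + M.
  by have := hM x; rewrite ler_norml => /andP[? _]; rewrite -lerBlDr sub0r.
pose f x := (h x + M)%:E.
have mf : measurable_fun setT f.
  by apply/measurable_EFinP; exact: measurable_funD.
have f0 x : setT x -> (0 <= f x)%E by rewrite lee_fin.
suff Qf : trig_multiplier (fun x => h x + M).
  rewrite [X in trig_multiplier X](_ : _ = fun x => (h x + M) + (- M)).
    by apply: multiplierD => //; exact: multiplier_cst.
  by apply/funext => x; rewrite addrK.
pose g := nnsfun_approx measurableT mf.
apply: (@multiplier_cvg g _ (M + M)).
- move=> n; rewrite (funext (fimfunEord (g n))).
  apply: multiplier_sum => k; apply: multiplierM; first exact: multiplier_cst.
  exact: multiplier_indic.
- move=> n x; rewrite ger0_norm; last exact: fun_ge0.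
  rewrite -lee_fin /g nnsfun_approxE (le_trans (le_approx _ _ _))//.
  by rewrite lee_fin lerD2r (le_trans (ler_norm _)).
- by move=> x; exact: (fine_cvg (cvg_nnsfun_approx measurableT mf f0 I)).
Qed.

(** The constant 1 is annihilated together with all trigonometric functions, and
    every bounded Borel h is a multiplier, so that h * 1 is annihilated too. *)
Lemma bounded_functional_eq0 :
  (forall t a, Lam (fun x => cos (dot t x + a)) = 0) ->
  forall h, bounded_borel h -> Lam h = 0.
Proof.
move=> Lam0 h /multiplier_bounded_borel[bh Qh].
have [_ /(_ 0 0)] := Qh (fun=> 1) (conj (bounded_borel_cst 1)
  (fun t a => etrans (congr1 Lam (eq_fun (fun x => mul1r _))) (Lam0 t a))).
congr (Lam _ = 0); apply/funext => x.
by rewrite /dot big1 ?addr0 ?cos0 ?mulr1// => i _; rewrite mxE mul0r.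
Qed.

End fourier_uniqueness.

(** * Densities and the exponential law *)

Section density.
Context {dT} {T : measurableType dT} {R : realType}.
Variables (mu nu : {measure set T -> \bar R}) (g : T -> R).
Hypotheses (mg : measurable_fun setT g) (g0 : forall x, 0 <= g x).
Hypothesis nuE : forall A, measurable A -> (nu A = \int[mu]_(x in A) (g x)%:E)%E.
Local Open Scope ereal_scope.

Import HBNNSimple.

Let ge0_integral_density_sfun (h : {nnsfun T >-> R}) :
  \int[nu]_x (h x)%:E = \int[mu]_x ((g x)%:E * (h x)%:E).
Proof.
under eq_integral do rewrite fimfunE -fsumEFin//.
rewrite ge0_integral_fsum//; last 2 first.
  - by move=> r; exact/measurable_EFinP/measurableT_comp.
  - by move=> r x _; rewrite EFinM nnfun_muleindic_ge0.
under [RHS]eq_integral.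
  move=> x _; rewrite fimfunE -fsumEFin// ge0_mule_fsumr; last first.
    by move=> r; rewrite EFinM nnfun_muleindic_ge0.
  over.
rewrite ge0_integral_fsum//; last 2 first.
  - move=> r; apply: emeasurable_funM; first exact/measurable_EFinP.
    exact/measurable_EFinP/measurableT_comp.
  - move=> r x _; apply: mule_ge0; first by rewrite lee_fin.
    by rewrite EFinM nnfun_muleindic_ge0.
apply: eq_fsbigr => r /set_mem[y _ <-].
under eq_integral do rewrite EFinM.
under [RHS]eq_integral do rewrite EFinM muleCA.
rewrite ge0_integralZl//; last 2 first.
  - exact/measurable_EFinP.
  - by rewrite lee_fin.
rewrite ge0_integralZl//; last 3 first.
  - by apply: emeasurable_funM; exact/measurable_EFinP.
  - by move=> x _; rewrite mule_ge0 ?lee_fin.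
  - by rewrite lee_fin.
congr *%E; rewrite integral_indic// setIT nuE//.
rewrite [LHS]integral_mkcond; apply: eq_integral => x _.
by rewrite patchE indicE; case: ifPn => _; rewrite ?mule1 ?mule0.
Qed.

Lemma ge0_integral_density (f : T -> \bar R) : measurable_fun setT f ->
  (forall x, 0 <= f x) -> \int[nu]_x f x = \int[mu]_x ((g x)%:E * f x).
Proof.
move=> mf f0.
pose h := nnsfun_approx measurableT mf.
have hf x : (h n x)%:E @[n --> \oo] --> f x by exact: cvg_nnsfun_approx.
transitivity (limn (fun n => \int[nu]_x (h n x)%:E)).
  rewrite -monotone_convergence//.
  - by apply: eq_integral => x _; apply/esym/cvg_lim.
  - by move=> n; exact/measurable_EFinP.
  - by move=> n x _; rewrite lee_fin.
  - by move=> x _ m n mn; rewrite lee_fin; exact/lefP/nd_nnsfun_approx.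
under eq_fun do rewrite ge0_integral_density_sfun.
rewrite -monotone_convergence//.
- by apply: eq_integral => x _; apply/cvg_lim => //; exact: cvgeZl.
- by move=> n; apply: emeasurable_funM; exact/measurable_EFinP.
- by move=> n x _; rewrite mule_ge0 ?lee_fin.
- move=> x _ m n mn; rewrite lee_wpmul2l ?lee_fin//.
  exact/lefP/nd_nnsfun_approx.
Qed.

(** The positive and the negative parts of both integrands correspond, hence so do
    the differences of their integrals, infinite or not. *)
Lemma integral_density (f : T -> \bar R) : measurable_fun setT f ->
  \int[nu]_x f x = \int[mu]_x ((g x)%:E * f x).
Proof.
move=> mf; rewrite [LHS]integralE [RHS]integralE.
rewrite !ge0_integral_density//; [|exact: measurable_funeneg|exact: measurable_funepos].
congr (_ - _); apply: eq_integral => x _.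
  by rewrite !funeposE maxe_pMr ?lee_fin// mule0.
by rewrite !funenegE maxe_pMr ?lee_fin// mule0 muleN.
Qed.

End density.

Section exp_law.
Context {R : realType}.

Definition exp_law : probability (measurableTypeR R) R.
Proof. by refine (exponential_prob (1 : R) : probability _ _); exact: ltr01. Defined.

Lemma integral_exp_law (F : R -> \bar R) : measurable_fun setT F ->
  (\int[exp_law]_z F z =
   \int[lebesgue_measure]_(z in `[0%R, +oo[) ((expR (- z))%:E * F z))%E.
Proof.
move=> mF; rewrite (@integral_density _ _ _ lebesgue_measure _ (exponential_pdf 1))//.
- rewrite [RHS]integral_mkcond; apply: eq_integral => z _.
  rewrite /exponential_pdf !patchE; case: ifPn => _; last by rewrite mul0e.
  by rewrite mul1r mulN1r.
- exact: measurable_exponential_pdf.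
- exact: exponential_pdf_ge0.
Qed.

(** For a = 0 and a = - pi / 2 these are the real and the imaginary part of
    1 / (1 - i u), the characteristic function of the exponential law. *)
Lemma Rintegral_exp_cos (u a : R) :
  \int[exp_law]_z cos (z * u + a) = (cos a - u * sin a) / (1 + u ^+ 2).
Proof.
have mcos : measurable_fun setT (fun z : R => cos (z * u + a)).
  by apply: measurable_cosD; exact: measurable_funM.
have icos : exp_law.-integrable setT (EFin \o (fun z : R => cos (z * u + a))).
  by apply: integrable_cos; exact: measurable_funM.
have i1 : exp_law.-integrable setT (EFin \o (fun z : R => 1)).
  by apply: (@bounded_integrable _ _ _ exp_law _ 1) => // z; rewrite normr1.
(* adding 1 makes the integrand nonnegative, as required by the fundamental
   theorem of calculus on a half-line *)
suff : \int[exp_law]_z (1 + cos (z * u + a)) =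
    1 + (cos a - u * sin a) / (1 + u ^+ 2).
  rewrite RintegralD// Rintegral_cst// mul1r.
  have -> : fine (exp_law setT) = 1 by rewrite probability_setT.
  by move/addrI.
rewrite /Rintegral integral_exp_law; last first.
  by apply/measurable_EFinP; exact: measurable_funD.
pose e z : R := expR (- z).
pose c z := cos (z * u + a).
pose s z := sin (z * u + a).
pose F := fun z => - e z + e z * (u * s z - c z) / (1 + u ^+ 2).
have u1 : 1 + u ^+ 2 != 0 by rewrite gt_eqF// ltr_wpDr ?sqr_ge0.
have dl (z : R) : is_derive z 1 (fun z => z * u + a) u.
  by apply: is_derive_eq; rewrite /GRing.scale /=; ring.
have dN (z : R) : is_derive z 1 (fun z : R => - z) (- 1) by exact: is_derive_eq.
have de (z : R) : is_derive z 1 e (- e z).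
  by have := is_derive1_comp (is_derive_expR (- z)) (dN z); rewrite mulrN1.
have dc (z : R) : is_derive z 1 c (- s z * u).
  by have := is_derive1_comp (is_derive_cos _) (dl z).
have ds (z : R) : is_derive z 1 s (c z * u).
  by have := is_derive1_comp (is_derive_sin _) (dl z).
have dF (z : R) : is_derive z 1 F (expR (- z) * (1 + cos (z * u + a))).
  rewrite /F; apply: is_derive_eq.
  by rewrite /GRing.scale /= -/(e z) -/(c z); field.
have df (z : R) : derivable (fun z => e z * (1 + c z)) z 1.
  apply: ex_derive; apply: is_derive_eq; reflexivity.
have e0 z : 0 <= e z by exact: expR_ge0.
have eoo : e z @[z --> +oo] --> (0 : R) by exact: cvgr_expR.
have Foo : F z @[z --> +oo] --> (0 : R).
  pose K := 1 + (`|u| + 1) / (1 + u ^+ 2).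
  have Kb z : `|F z| <= e z * K.
    rewrite /F /K [leRHS]mulrDr mulr1 (le_trans (ler_normD _ _))// lerD//.
      by rewrite normrN ger0_norm.
    rewrite mulrA !normrM normfV ler_pM ?invr_ge0//.
      by rewrite ger0_norm// ler_wpM2l// (le_trans (ler_normB _ _))// lerD//
        ?normrM ?ler_piMr// ler_norml ?cos_geN1 ?cos_le1 ?sin_geN1 ?sin_le1.
    by rewrite ger0_norm// addr_ge0// sqr_ge0.
  have eK : e z * K @[z --> +oo] --> (0 : R).
    by rewrite -[X in _ --> X](mul0r K); exact: cvgMl.
  apply: norm_cvg0; apply: (squeeze_cvgr _ (cvg_cst 0) eK).
  by apply: nearW => z; rewrite Kb normr_ge0.
under eq_integral do rewrite -EFinM.
rewrite (@ge0_continuous_FTC2y _ (fun z => e z * (1 + c z)) F 0 0)//.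
- by rewrite /F /e /c /s !mul0r !add0r oppr0 expR0 /=; field.
- by move=> z _; rewrite mulr_ge0// -lerBlDl sub0r cos_geN1.
- by apply: derivable_within_continuous => z _; exact: df.
- apply: cvg_at_right_filter; apply: differentiable_continuous.
  exact/derivable1_diffP.
- by move=> z _; rewrite derive1E derive_val.
Qed.

(** Any finite bound would serve. This one comes from the bound
    z e^(-z) <= 2 e^(-z/2), the right-hand side being 4 times the density of
    the exponential law of rate 1/2. *)
Lemma integral_exp_id : (\int[exp_law]_z `|z|%:E <= 4%:E)%E.
Proof.
rewrite integral_exp_law; last by apply/measurable_EFinP; exact: normr_measurable.
pose g (z : R) := exponential_pdf 2^-1 z.
have g0 z : 0 <= g z by apply: exponential_pdf_ge0; rewrite invr_ge0.
have mg : measurable_fun setT (fun z => (g z)%:E).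
  by apply/measurable_EFinP; exact: measurable_exponential_pdf.
apply: (@le_trans _ _ (\int[lebesgue_measure]_(z in `[0%R, +oo[) (4%:E * (g z)%:E))%E).
  apply: ge0_le_integral => //.
  - apply: emeasurable_funM; apply/measurable_EFinP/measurable_funTS.
      by apply: measurableT_comp => //; exact: oppr_measurable.
    exact: normr_measurable.
  - by apply: emeasurable_funM => //; exact: measurable_funTS.
  - move=> z /=; rewrite in_itv/= andbT => z0.
    rewrite -!EFinM lee_fin ger0_norm// /g exponential_pdfE//.
    have -> : expR (- z) = expR (- 2^-1 * z) * expR (- 2^-1 * z).
      by rewrite -expRD; congr expR; field.
    rewrite (_ : 4 * _ = expR (- 2^-1 * z) * 2); last by field.
    rewrite -mulrA ler_wpM2l ?expR_ge0//.
    rewrite mulNr expRN mulrC ler_pdivrMr ?expR_gt0//.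
    by have := expR_ge1Dx (2^-1 * z); lra.
rewrite ge0_integralZl//; last 2 first.
  - exact: measurable_funTS.
  - by move=> z _; rewrite lee_fin.
rewrite -[leRHS]mule1 lee_wpmul2l//.
rewrite -(integral_exponential_pdf (_ : 0 < 2^-1)) ?invr_gt0//.
by apply: ge0_subset_integral => // z _; rewrite lee_fin.
Qed.

End exp_law.

(** * Differentiation under the integral *)

Section shifted_integral.
Context {dT} {T : measurableType dT} {R : realType}.
Variables (mu : {measure set T -> \bar R}) (D : set T) (mD : measurable D).
Variables (l l' : R -> R) (p q : T -> R).
Hypothesis dl : forall u : R, is_derive u 1 l (l' u).
Hypothesis l'_le1 : forall u, `|l' u| <= 1.
Hypothesis il : forall h, mu.-integrable D (EFin \o (fun x => l (p x + h * q x))).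
Hypothesis iq : mu.-integrable D (EFin \o q).

(** All the derivatives that are needed have this form: |q| dominates the difference
    quotients because l is 1-Lipschitz. *)
Lemma is_derive_integral_shift :
  is_derive (0 : R) 1 (fun h => \int[mu]_(x in D) l (p x + h * q x))
    (\int[mu]_(x in D) (l' (p x) * q x)).
Proof.
pose f (h : R) x := l (p x + h * q x).
have df (h : R) x : is_derive h 1 (f ^~ x) (l' (p x + h * q x) * q x).
  have dL : is_derive h 1 (fun h => p x + h * q x) (q x).
    by apply: is_derive_eq; rewrite /GRing.scale /=; ring.
  by have := is_derive1_comp (dl _) dL.
have I0 : `](-1), 1[%classic (0 : R) by rewrite /= in_itv/= ltrN10 ltr01.
have G0 x : 0 <= `|q x| by [].
have iG : mu.-integrable D (EFin \o (fun x => `|q x|)).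
  by have := integrable_abse iq.
have d1 (h : R) x : `](-1), 1[%classic h -> D x -> derivable (f ^~ x) h 1.
  by move=> _ _; exact: ex_derive.
have Gub (h : R) x : `](-1), 1[%classic h -> D x -> `|partial1of2 f h x| <= `|q x|.
  move=> _ _; rewrite partial1of2E (@derive_val _ _ _ _ _ _ _ (df h x)).
  by rewrite normrM ler_piMl.
have intf (h : R) : `](-1), 1[%classic h -> mu.-integrable D (EFin \o f h).
  by move=> _; exact: il.
have dF := derivable_under_integral mD I0 intf d1 G0 iG Gub.
have DF := differentiation_under_integral mD I0 intf d1 G0 iG Gub.
apply: DeriveDef => //; rewrite -derive1E DF.
apply: eq_Rintegral => x _; rewrite partial1of2E.
by rewrite (@derive_val _ _ _ _ _ _ _ (df 0 x)) mul0r addr0.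
Qed.

End shifted_integral.

(** * The characteristic function in real form *)

Section complex_log.
Context {R : realType}.
Local Open Scope complex_scope.

Lemma cexp_i (u : R) : cexp ('i * u%:C) = cos u +i* sin u.
Proof.
have -> : 'i * u%:C = 0 +i* u by simpc.
by rewrite /cexp /= expR0 !mul1r.
Qed.

Lemma clog_1Bi (u : R) :
  clog (1 - 'i * u%:C) = (2^-1 * ln (1 + u ^+ 2)) +i* (- atan u).
Proof.
have zE : 1 - 'i * u%:C = 1 +i* (- u) by simpc.
have u1 : 0 < 1 + u ^+ 2 by rewrite ltr_wpDr ?sqr_ge0.
rewrite zE /clog /carg /ComplexField.Normc.normc /= expr1n sqrrN.
congr (_ +i* _).
  have := lnXn 2 (_ : 0 < Num.sqrt (1 + u ^+ 2)).
  by rewrite sqrtr_gt0 sqr_sqrtr ?ltW// => /(_ u1) ->; field.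
have acosE v : 0 <= v -> acos (1 / Num.sqrt (1 + v ^+ 2)) = atan v.
  move=> v0; rewrite mul1r -cos_atan cosK// in_itv/=.
  rewrite -{1}atan0 le_atan//= (le_trans (ltW (atan_ltpi2 v)))//.
  by rewrite ler_pdivrMr// ler_peMr ?pi_ge0// ler1n.
rewrite oppr_ge0; case: (lerP u 0) => u0.
  by rewrite -sqrrN acosE ?oppr_ge0// atanN.
by rewrite acosE // ltW.
Qed.

End complex_log.

Section orthant_theory.
Context {R : realType} {d : nat}.

Lemma measurable_orthant : measurable (@orthant R d).
Proof.
rewrite [X in measurable X](_ : _ =
    [set s : 'rV[R]_d | forall i, `[0, +oo[%classic (s 0 i)]).
  exact: measurable_coord_box.
apply/seteqP; split => s s0 i.
  by rewrite /= in_itv/= andbT; exact: s0.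
by have := s0 i; rewrite /= in_itv/= andbT.
Qed.

Lemma abs_coord_le_enorm (s : 'rV[R]_d) j : `|s 0 j| <= enorm s.
Proof.
rewrite -sqrtr_sqr ler_wsqrtr// /dot (bigD1 j)//= -expr2 lerDl.
by apply: sumr_ge0 => i _; rewrite -expr2 sqr_ge0.
Qed.

Lemma measurable_enorm : measurable_fun setT (@enorm R d).
Proof.
apply: (@measurableT_comp _ _ _ _ _ _ (@Num.sqrt R) _ (fun s => dot s s));
  last exact: measurable_dot.
by apply: continuous_measurable_fun; exact: sqrt_continuous.
Qed.

End orthant_theory.

Section mggc_characteristic_function.
Context {disp : measure_display} {O : measurableType disp} {R : realType}.
Context {d : nat} (P : probability O R) (X : {RV P >-> 'rV[R]_d}).
Variable nu : {measure set 'rV[R]_d -> \bar R}.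
Hypothesis nu_norm : (\int[nu]_(s in orthant) (enorm s)%:E < +oo)%E.
Hypothesis X_mggc : mggc X nu.

Definition minus_log_modulus t := \int[nu]_(s in orthant) (2^-1 * ln (1 + dot s t ^+ 2)).
Definition phase t := \int[nu]_(s in orthant) atan (dot s t).

Lemma measurable_dotX t : measurable_fun setT (fun w => dot t (X w)).
Proof. by apply: measurable_dot. Qed.

Lemma integrable_coord j : nu.-integrable orthant (fun s => (s 0 j)%:E).
Proof.
have mO := @measurable_orthant R d.
apply: (@le_integrable _ _ _ _ _ mO _ (fun s => (enorm s)%:E)).
- by apply/measurable_EFinP/measurable_funTS; exact: measurable_coord.
- move=> s _ /=; rewrite lee_fin (le_trans (abs_coord_le_enorm s j))//.
  exact: ler_norm.
- apply/integrableP; split.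
    by apply/measurable_EFinP/measurable_funTS; exact: measurable_enorm.
  under eq_integral do rewrite /= ger0_norm ?sqrtr_ge0//.
  exact: nu_norm.
Qed.

Lemma integrable_log t :
  nu.-integrable orthant (EFin \o (fun s => 2^-1 * ln (1 + dot s t ^+ 2))).
Proof.
have [_ /(_ t)[[+ _] _]] := X_mggc.
apply: (eq_integrable measurable_orthant) => s _.
exact: (congr1 (fun z => (complex.Re z)%:E) (clog_1Bi _)).
Qed.

Lemma integrable_atan t : nu.-integrable orthant (EFin \o (fun s => atan (dot s t))).
Proof.
have [_ /(_ t)[[_ +] _]] := X_mggc.
move=> /integrableN.
apply: (eq_integrable measurable_orthant) => s _.
have := congr1 (fun z => (- complex.Im z)%:E) (clog_1Bi (dot s t)).
by rewrite /= opprK.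
Qed.

(** The phase a encodes real and imaginary part at once, and it turns the family of
    all cosines into one that is closed under translations of the argument. *)
Lemma mggc_cosE t a : \int[P]_w cos (dot t (X w) + a) =
  expR (- minus_log_modulus t) * cos (phase t + a).
Proof.
have reE : \int[nu]_(s in orthant) complex.Re (clog (1 - 'i * (dot s t)%:C))%C =
    minus_log_modulus t.
  by apply: eq_Rintegral => s _; rewrite clog_1Bi.
have imE : \int[nu]_(s in orthant) complex.Im (clog (1 - 'i * (dot s t)%:C))%C =
    - phase t.
  rewrite /phase -mulN1r -RintegralZl; [|exact: measurable_orthant|exact: integrable_atan].
  by apply: eq_Rintegral => s _; rewrite clog_1Bi mulN1r.
have [_ /(_ t)[_]] := X_mggc.
rewrite /is_log /char_fun /cintegral reE imE.
under eq_Rintegral do rewrite cexp_i /=.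
under [X in _ = Complex _ X]eq_Rintegral do rewrite cexp_i /=.
rewrite /cexp /= opprK => -[rphi iphi].
have icos : P.-integrable setT (EFin \o (fun w => cos (dot t (X w)))).
  have := integrable_cos P 0 (measurable_dotX t).
  by apply: eq_integrable => // w _ /=; rewrite addr0.
have isin : P.-integrable setT (EFin \o (fun w => sin (dot t (X w)))).
  have := integrable_cos P (- (pi / 2)) (measurable_dotX t).
  by apply: eq_integrable => // w _ /=; rewrite cosBpihalf.
under eq_Rintegral do rewrite cosD.
rewrite RintegralB//; last 2 first.
- by have := integrableZr measurableT (cos a) icos; apply: eq_integrable.
- by have := integrableZr measurableT (sin a) isin; apply: eq_integrable.
by rewrite !RintegralZr// cosD mulrBr !mulrA rphi iphi.
Qed.

End mggc_characteristic_function.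

(** * First moments and the derivative of the characteristic function *)

Section mggc_moments.
Context {disp : measure_display} {O : measurableType disp} {R : realType}.
Context {d : nat} (P : probability O R) (X : {RV P >-> 'rV[R]_d}).
Variable nu : {measure set 'rV[R]_d -> \bar R}.
Hypothesis nu_norm : (\int[nu]_(s in orthant) (enorm s)%:E < +oo)%E.
Hypothesis X_mggc : mggc X nu.
Let mO := @measurable_orthant R d.
Let X_ge0 w j : 0 <= X w 0 j.
Proof. by case: X_mggc => + _; exact. Qed.

Let dot_shift (s t : 'rV[R]_d) j h :
  dot s (t + h *: delta_mx 0 j) = dot s t + h * s 0 j.
Proof. by rewrite dotDr dotZr (dotC s (delta_mx _ _)) dot_delta. Qed.

Lemma is_derive_minus_log_modulus t j :
  is_derive (0 : R) 1 (fun h => minus_log_modulus nu (t + h *: delta_mx 0 j))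
    (\int[nu]_(s in orthant) (dot s t / (1 + dot s t ^+ 2) * s 0 j)).
Proof.
rewrite /minus_log_modulus.
under [X in is_derive _ _ X]eq_fun do under eq_Rintegral do rewrite dot_shift.
apply: (@is_derive_integral_shift _ _ _ _ _ mO
  (fun u => 2^-1 * ln (1 + u ^+ 2)) (fun u => u / (1 + u ^+ 2))).
- exact: is_derive_half_ln1D.
- exact: abs_poisson_le1.
- move=> h; have := integrable_log X_mggc (t + h *: delta_mx 0 j).
  by apply: (eq_integrable mO) => s _ /=; rewrite dot_shift.
- exact: integrable_coord.
Qed.

Lemma is_derive_phase t j :
  is_derive (0 : R) 1 (fun h => phase nu (t + h *: delta_mx 0 j))
    (\int[nu]_(s in orthant) ((1 + dot s t ^+ 2)^-1 * s 0 j)).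
Proof.
rewrite /phase.
under [X in is_derive _ _ X]eq_fun do under eq_Rintegral do rewrite dot_shift.
apply: (@is_derive_integral_shift _ _ _ _ _ mO atan (fun u => (1 + u ^+ 2)^-1)).
- exact: abs_inv_one_sqr_le1.
- move=> h; have := integrable_atan X_mggc (t + h *: delta_mx 0 j).
  by apply: (eq_integrable mO) => s _ /=; rewrite dot_shift.
- exact: integrable_coord.
Qed.

Lemma mggc_sinE t a : \int[P]_w sin (dot t (X w) + a) =
  expR (- minus_log_modulus nu t) * sin (phase nu t + a).
Proof.
have := mggc_cosE X_mggc t (a - pi / 2); rewrite addrA cosBpihalf => <-.
by apply: eq_Rintegral => w _; rewrite addrA cosBpihalf.
Qed.

Lemma minus_log_modulus_ge0 t : 0 <= minus_log_modulus nu t.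
Proof.
apply: Rintegral_ge0 => s _; rewrite mulr_ge0// ln_ge0// lerDl.
by rewrite sqr_ge0.
Qed.

Lemma phase_le j h :
  `|phase nu (h *: delta_mx 0 j)| <= `|h| * \int[nu]_(s in orthant) s 0 j.
Proof.
have iphase := integrable_atan X_mggc (h *: delta_mx 0 j).
rewrite (le_trans (le_normr_Rintegral mO iphase))//.
rewrite -RintegralZl//; last exact: integrable_coord.
apply: le_Rintegral => //.
- by have := integrable_abse iphase.
- have := integrableZl mO `|h| (integrable_coord nu_norm j).
  by apply: (eq_integrable mO).
- move=> s s0; rewrite (le_trans (abs_atan_le _))//.
  by rewrite dotZr (dotC s (delta_mx _ _)) dot_delta normrM (ger0_norm (s0 j)).
Qed.

Let C j := \int[nu]_(s in orthant) s 0 j.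

Let C_ge0 j : 0 <= C j.
Proof. by apply: Rintegral_ge0 => s s0; exact: s0. Qed.

(** The left-hand side is E [K (e X_j)] for the nonnegative kernel
    K (u) = u / (1 + u^2), which is the exponential average of sin (z u) over z. By
    Fubini's theorem it is the average over z of the imaginary part of the characteristic
    function at z e times the j-th basis vector, and this is at most the phase,
    hence at most z e times the j-th mean of nu. *)
Lemma expectation_poisson_le j (e : R) : 0 < e ->
  (\int[P]_w (e * X w 0 j / (1 + (e * X w 0 j) ^+ 2))%:E <= (e * (4 * C j))%:E)%E.
Proof.
move=> e0.
pose f (p : measurableTypeR R * O) := sin (p.1 * (e * X p.2 0 j)).
have mf : measurable_fun setT f.
  apply: (@measurableT_comp _ _ _ _ _ _ (@sin R)).
    by apply: continuous_measurable_fun; exact: continuous_sin.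
  apply: measurable_funM; first exact: measurable_fst.
  apply: measurable_funM => //.
  apply: measurableT_comp (measurable_coord j) _.
  exact: measurableT_comp measurable_snd.
have f1 p : `|f p| <= 1 by rewrite ler_norml sin_geN1 sin_le1.
have intf : (exp_law \x P)%E.-integrable setT (EFin \o f) by exact: bounded_integrable mf f1.
have fE w z : f (z, w) = cos (z * (e * X w 0 j) + - (pi / 2)) by rewrite cosBpihalf.
have innerE w : (\int[exp_law]_z (f (z, w))%:E =
    (e * X w 0 j / (1 + (e * X w 0 j) ^+ 2))%:E)%E.
  have := Rintegral_exp_cos (e * X w 0 j) (- (pi / 2)).
  rewrite cosN cos_pihalf sinN sin_pihalf mulrN1 opprK add0r => <-.
  rewrite /Rintegral fineK; first by apply: eq_integral => z _; rewrite fE.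
  apply: integrable_fin_num => //.
  apply: (@bounded_integrable _ _ _ _ _ 1) => [|z]; last by rewrite ler_norml cos_geN1 cos_le1.
  by apply: measurable_cosD; exact: measurable_funM.
under eq_integral do rewrite -innerE.
rewrite -(Fubini intf) /=.
have outerE z : (\int[P]_w (f (z, w))%:E =
    (expR (- minus_log_modulus nu ((z * e) *: delta_mx 0 j)) *
       sin (phase nu ((z * e) *: delta_mx 0 j)))%:E)%E.
  have := mggc_sinE ((z * e) *: delta_mx 0 j) 0; rewrite addr0 => <-.
  rewrite /Rintegral fineK.
    by apply: eq_integral => w _; rewrite addr0 dotZl dot_delta /f /= mulrA.
  apply: integrable_fin_num => //.
  apply: (@bounded_integrable _ _ _ _ _ 1) => [|w]; last by rewrite ler_norml sin_geN1 sin_le1.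
  have := measurable_cosD (- (pi / 2)) (measurable_dotX X ((z * e) *: delta_mx 0 j)).
  by under eq_fun do rewrite cosBpihalf -[dot _ _]addr0.
apply: (@le_trans _ _ (\int[exp_law]_z ((e * C j)%:E * `|z|%:E))%E); last first.
  rewrite ge0_integralZl//; last 2 first.
  - by apply/measurable_EFinP; exact: normr_measurable.
  - by rewrite lee_fin mulr_ge0// ltW.
  rewrite (_ : e * (4 * C j) = (e * C j) * 4); last by ring.
  by rewrite [leRHS]EFinM lee_wpmul2l ?integral_exp_id// lee_fin mulr_ge0// ltW.
apply: le_integral => //.
- exact: integrable_fubini_F intf.
- apply/integrableP; split.
    apply: emeasurable_funM => //.
    by apply/measurable_EFinP; exact: normr_measurable.
  under eq_integral do rewrite gee0_abs ?mule_ge0 ?lee_fin ?mulr_ge0 ?(ltW e0)//.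
  rewrite ge0_integralZl//; last 2 first.
  - by apply/measurable_EFinP; exact: normr_measurable.
  - by rewrite lee_fin mulr_ge0// ltW.
  apply: lte_mul_pinfty => //; first by rewrite lee_fin mulr_ge0// ltW.
  exact: le_lt_trans integral_exp_id (ltry _).
- move=> z _; rewrite outerE -EFinM lee_fin.
  rewrite (le_trans (ler_norm _))// normrM -[leRHS]mul1r ler_pM//.
    by rewrite ger0_norm ?expR_ge0// expR_le1 oppr_le0 minus_log_modulus_ge0.
  have -> : e * C j * `|z| = `|z * e| * C j.
    by rewrite normrM (gtr0_norm e0); ring.
  exact: le_trans (abs_sin_le _) (phase_le _ _).
Qed.

(** Dividing the previous bound by e and letting e tend to 0, the integrand increases
    to X_j. *)
Lemma mggc_coord_integrable j : P.-integrable setT (fun w => (X w 0 j)%:E).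
Proof.
have mX : measurable_fun setT (fun w => X w 0 j).
  exact: measurableT_comp (measurable_coord j) _.
apply/integrableP; split; first exact/measurable_EFinP.
under eq_integral do rewrite gee0_abs ?lee_fin//.
pose e n : R := n.+1%:R^-1.
have e0 n : 0 < e n by rewrite invr_gt0.
pose K n w := X w 0 j / (1 + (e n * X w 0 j) ^+ 2).
have K0 n w : 0 <= K n w.
  by rewrite divr_ge0// ltW// one_sqr_gt0.
have mK n : measurable_fun setT (K n).
  apply: measurable_funM => //.
  by apply: (measurableT_comp measurable_inv_one_sqr); exact: measurable_funM.
have Kcvg w : K n w @[n --> \oo] --> X w 0 j.
  rewrite -[X in _ --> X]divr1 -[X in _ / X]addr0 -[X in _ + X](mulr0 0).
  rewrite -[X in X * X](mul0r (X w 0 j)).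
  apply: cvgMr; apply: cvgV; first by rewrite mul0r mulr0 addr0 oner_eq0.
  apply: cvgD; first exact: cvg_cst.
  by apply: cvgM; apply: cvgMl; exact: cvg_harmonic.
have Knd w : nondecreasing_seq (K ^~ w).
  move=> m n mn; rewrite /K ler_wpM2l// lef_pV2 ?posrE ?one_sqr_gt0//.
  rewrite lerD2l lerXn2r ?nnegrE ?mulr_ge0 ?(ltW (e0 _))//.
  by rewrite ler_wpM2r// lef_pV2 ?posrE// ler_nat.
have Kle n : (\int[P]_w (K n w)%:E <= (4 * C j)%:E)%E.
  have := expectation_poisson_le j (e0 n).
  rewrite (eq_integral (fun w => (e n)%:E * (K n w)%:E)%E); last first.
    by move=> w _; rewrite -EFinM mulrA.
  rewrite ge0_integralZl//; last 3 first.
  - by apply/measurable_EFinP; exact: mK.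
  - by move=> w _; rewrite lee_fin K0.
  - by rewrite lee_fin ltW.
  by rewrite [leRHS]EFinM lee_pmul2l// lte_fin.
have IK : (\int[P]_w (K n w)%:E @[n --> \oo] --> \int[P]_w (X w 0 j)%:E)%E.
  rewrite [X in _ --> X](_ : _ = \int[P]_w limn (fun n => (K n w)%:E))%E.
    apply: cvg_monotone_convergence => //.
    - by move=> n; exact/measurable_EFinP.
    - by move=> n w _; rewrite lee_fin.
    - by move=> w _ m n mn; rewrite lee_fin Knd.
  apply: eq_integral => w _; apply/esym/cvg_lim => //.
  by apply: cvg_EFin; [exact: nearW|exact: Kcvg].
rewrite -(cvg_lim _ IK)//; apply: le_lt_trans (ltry (4 * C j)).
by apply: lime_le; [exact: cvgP IK|exact: nearW].
Qed.

(** The two sides are the derivatives at h = 0 of the two expressions of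
    E [sin (<t + h e_j, X> + a)]. *)
Lemma mggc_size_bias_cos t a j :
  \int[P]_w (X w 0 j * cos (dot t (X w) + a)) =
  (\int[nu]_(s in orthant) ((1 + dot s t ^+ 2)^-1 * s 0 j)) *
    (\int[P]_w cos (dot t (X w) + a)) -
  (\int[nu]_(s in orthant) (dot s t / (1 + dot s t ^+ 2) * s 0 j)) *
    (\int[P]_w sin (dot t (X w) + a)).
Proof.
set b := (X in _ = X * _ - _); set c := (X in _ = _ - X * _).
pose H h := \int[P]_w sin ((dot t (X w) + a) + h * X w 0 j).
have HE : H = fun h => expR (- minus_log_modulus nu (t + h *: delta_mx 0 j)) *
                       sin (phase nu (t + h *: delta_mx 0 j) + a).
  apply/funext => h; rewrite -mggc_sinE; apply: eq_Rintegral => w _.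
  by rewrite [dot (_ + _) _]dotC dot_shift [dot (X w) t]dotC addrAC.
have dH1 : is_derive (0 : R) 1 H (\int[P]_w (cos (dot t (X w) + a) * X w 0 j)).
  apply: (is_derive_integral_shift measurableT).
  - by move=> u; rewrite ler_norml cos_geN1 cos_le1.
  - move=> h; have := integrable_cos P (a - pi / 2) (measurable_dotX X (t + h *: delta_mx 0 j)).
    apply: eq_integrable => // w _ /=.
    by rewrite addrA cosBpihalf [dot (_ + _) _]dotC dot_shift [dot (X w) t]dotC addrAC.
  - exact: mggc_coord_integrable.
have dA := is_derive_minus_log_modulus t j; have dB := is_derive_phase t j.
have dB' : is_derive (0 : R) 1 (fun h => phase nu (t + h *: delta_mx 0 j) + a) b.
  by apply: is_derive_eq; rewrite addr0.
have dA' : is_derive (0 : R) 1 (fun h => - minus_log_modulus nu (t + h *: delta_mx 0 j)) (- c).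
  exact: is_derive_eq.
have de := is_derive1_comp (is_derive_expR _) dA'.
have ds := is_derive1_comp (is_derive_sin _) dB'.
have := @derive_val _ _ _ _ _ _ _ dH1.
rewrite HE (@derive_val _ _ _ _ _ _ _ (is_deriveM de ds)) /= scale0r addr0.
rewrite (mggc_cosE X_mggc) mggc_sinE => E.
transitivity (\int[P]_w (cos (dot t (X w) + a) * X w 0 j)).
  by apply: eq_Rintegral => w _; rewrite mulrC.
by rewrite -E /GRing.scale /=; ring.
Qed.

End mggc_moments.

(** * The size-bias identity *)

Section weighted_functional.
Context {R : realType} {d : nat}.
Context {dT} {T : measurableType dT} (m : {measure set T -> \bar R}).
Variables (g : T -> R) (Z : T -> 'rV[R]_d).
Hypotheses (ig : m.-integrable setT (EFin \o g)) (mZ : measurable_fun setT Z).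

Let mg : measurable_fun setT g.
Proof. by apply/measurable_EFinP; exact: measurable_int ig. Qed.

Lemma integrable_weighted h : bounded_borel h ->
  m.-integrable setT (fun x => (g x * h (Z x))%:E).
Proof.
move=> [mh [M hM]].
apply: (@le_integrable _ _ _ _ _ measurableT _ (fun x => M%:E * (g x)%:E)%E).
- apply/measurable_EFinP; apply: measurable_funM => //.
  exact: measurableT_comp mh mZ.
- move=> x _; rewrite -EFinM !abse_EFin lee_fin !normrM mulrC ler_wpM2r//.
  exact: le_trans (hM _) (ler_norm _).
- exact: integrableZl.
Qed.

Lemma weighted_bounded_functional :
  bounded_functional (fun h => \int[m]_x (g x * h (Z x))).
Proof.
split=> [f h bf bh|c f bf|h_ h M mh hM hh].
- under eq_Rintegral do rewrite mulrDr.
  by rewrite RintegralD//; exact: integrable_weighted.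
- under eq_Rintegral do rewrite mulrCA.
  by rewrite RintegralZl//; exact: integrable_weighted.
- have bh := bounded_borel_cvg mh hM hh.
  apply: fine_cvg; rewrite fineK; last first.
    by apply: integrable_fin_num => //; exact: integrable_weighted.
  apply: (@dominated_cvg _ _ _ _ _ measurableT _ _ (fun x => `|M%:E * (g x)%:E|)%E).
  + move=> n; apply/measurable_EFinP; apply: measurable_funM => //.
    exact: measurableT_comp (mh n) mZ.
  + move=> x _; apply: cvg_EFin; first exact: nearW.
    by apply: cvgMr; exact: hh.
  + by move=> x _.
  + by apply: integrable_abse; exact: integrableZl.
  + move=> n x _; rewrite -EFinM !abse_EFin lee_fin !normrM mulrC ler_wpM2r//.
    exact: le_trans (hM _ _) (ler_norm _).
Qed.

End weighted_functional.

Lemma EFin_Rintegral {dT} {T : measurableType dT} {R : realType}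
    (m : {measure set T -> \bar R}) (f : T -> R) :
  m.-integrable setT (EFin \o f) -> ((\int[m]_x f x)%:E = \int[m]_x (f x)%:E)%E.
Proof. by move=> fi; rewrite fineK//; exact: integrable_fin_num. Qed.

Section product_with_probability.
Context {d1 d2} {T1 : measurableType d1} {T2 : measurableType d2} {R : realType}.
Variables (m : {sigma_finite_measure set T1 -> \bar R}) (P : probability T2 R).

(** The product measure under a name of its own, which carries the structure of
    a sigma-finite measure and so can be a factor of a further product. *)
Definition product_with : set (T1 * T2) -> \bar R := (m \x P)%E.

HB.instance Definition _ := Measure.copy product_with (m \x P)%E.

Let product_with_sigma_finite : sigma_finite setT product_with.
Proof.
have [F FT Foo] := sigma_finiteT m.
exists (fun n => F n `*` setT) => [|n].
  apply/seteqP; split => // -[x y] _.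
  by have [n _ Fnx] : (\bigcup_n F n) x by [rewrite -FT]; exists n.
have [mF mFoo] := Foo n; split; first exact: measurableX.
by rewrite /product_with product_measure1E// [X in (_ * X)%E]probability_setT mule1.
Qed.

HB.instance Definition _ := Measure_isSigmaFinite.Build _ _ _ product_with
  product_with_sigma_finite.

Lemma integrable_comp_fst (g : T1 -> \bar R) : m.-integrable setT g ->
  product_with.-integrable setT (g \o fst).
Proof.
move=> ig; have mg := measurable_int _ ig.
apply/integrable12ltyP; first exact: measurableT_comp measurable_fst.
rewrite (eq_integral (fun x => `|g x|)%E); last first.
  by move=> x _; rewrite /= integral_cst// [X in (_ * X)%E]probability_setT mule1.
by have /integrableP[] := ig.
Qed.

Lemma integral_product_with (g : T1 * T2 -> \bar R) : product_with.-integrable setT g ->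
  (\int[product_with]_p g p = \int[m]_x \int[P]_y g (x, y))%E.
Proof. by move=> ig; rewrite -integral12_prod_meas1. Qed.

End product_with_probability.

Section size_bias.
Context {disp : measure_display} {O : measurableType disp} {R : realType}.
Context {d : nat} (P : probability O R) (X : {RV P >-> 'rV[R]_d}).
Variable nu : {sigma_finite_measure set 'rV[R]_d -> \bar R}.
Hypothesis nu_orthant : nu (~` orthant) = 0%E.
Hypothesis nu_norm : (\int[nu]_(s in orthant) (enorm s)%:E < +oo)%E.
Hypothesis X_mggc : mggc X nu.

Let mO := @measurable_orthant R d.

Lemma integral_orthant (f : 'rV[R]_d -> \bar R) : measurable_fun setT f ->
  (\int[nu]_(s in orthant) f s = \int[nu]_s f s)%E.
Proof.
move=> mf; rewrite integral_mkcond; apply: ae_eq_integral => //.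
  by apply/(measurable_restrictT _ mO); exact: measurable_funTS.
exists (~` orthant); split => //; first exact: measurableC.
move=> s /= ns; apply: contra_not ns => Os _.
by rewrite patchE mem_set.
Qed.

Notation space := (('rV[R]_d * measurableTypeR R) * O)%type.
Notation jump := (product_with nu exp_law).
Notation joint := (product_with jump P).

(** The point X + z s, for ((s, z), w) in the product of nu, the exponential law
    and P. *)
Definition shifted (p : space) : 'rV[R]_d :=
  X p.2 + p.1.2 *: p.1.1.

Lemma measurable_shifted : measurable_fun setT shifted.
Proof.
apply: measurable_rV => i; rewrite /shifted.
under eq_fun do rewrite !mxE.
have m1 : measurable_fun setT (fun p : space => p.1.1).
  exact: measurableT_comp measurable_fst measurable_fst.
apply: measurable_funD.
  apply: measurableT_comp (measurable_coord i) _.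
  exact: measurableT_comp measurable_snd.
apply: measurable_funM; first exact: measurableT_comp measurable_snd measurable_fst.
exact: measurableT_comp (measurable_coord i) m1.
Qed.

Lemma integrable_coordT j : nu.-integrable setT (fun s => (s 0 j)%:E).
Proof.
have mj : measurable_fun setT (fun s : 'rV[R]_d => (s 0 j)%:E).
  by apply/measurable_EFinP; exact: measurable_coord.
apply/integrableP; split => //.
rewrite -integral_orthant; last exact: measurableT_comp.
by have /integrableP[] := integrable_coord nu_norm j.
Qed.

Lemma joint_integrable_coord j : joint.-integrable setT (EFin \o (fun p : space => p.1.1 0 j)).
Proof.
have ij := integrable_comp_fst exp_law (integrable_coordT j).
exact: (integrable_comp_fst P ij).
Qed.

Lemma integrable_coordM (k : 'rV[R]_d -> R) j : measurable_fun setT k ->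
  (forall s, `|k s| <= 1) -> nu.-integrable setT (fun s => (k s * s 0 j)%:E).
Proof.
move=> mk k1; apply: le_integrable (integrable_coordT j) => //.
  by apply/measurable_EFinP; apply: measurable_funM => //; exact: measurable_coord.
by move=> s _; rewrite !abse_EFin lee_fin normrM ler_piMl.
Qed.

(** On the side of the product measure, the integral over w is given by the
    characteristic function with phase a + z <s, t>, and then the integral over z by that
    of the exponential law. *)
Lemma size_bias_cos t a j :
  \int[P]_w (X w 0 j * cos (dot t (X w) + a)) =
  \int[joint]_p (p.1.1 0 j * cos (dot t (shifted p) + a)).
Proof.
have ijoint : joint.-integrable setT
    (EFin \o (fun p : space => p.1.1 0 j * cos (dot t (shifted p) + a))).
  have := integrable_weighted (joint_integrable_coord j) measurable_shifted
    (bounded_borel_cos t a).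
  exact.
have mdot : measurable_fun setT (fun s : 'rV[R]_d => dot s t) by exact: measurable_dot.
have minv : measurable_fun setT (fun s : 'rV[R]_d => (1 + dot s t ^+ 2)^-1).
  exact: (measurableT_comp measurable_inv_one_sqr mdot).
pose E := expR (- minus_log_modulus nu t); pose B := phase nu t + a.
have ib : nu.-integrable setT (fun s => ((1 + dot s t ^+ 2)^-1 * s 0 j)%:E).
  by apply: integrable_coordM => // s; exact: abs_inv_one_sqr_le1.
have ic : nu.-integrable setT (fun s => (dot s t / (1 + dot s t ^+ 2) * s 0 j)%:E).
  apply: integrable_coordM => [|s]; last exact: abs_poisson_le1.
  exact: measurable_funM.
rewrite (mggc_size_bias_cos nu_norm X_mggc) (mggc_cosE X_mggc) (mggc_sinE X_mggc) -/E -/B.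
pose G (q : 'rV[R]_d * measurableTypeR R) : \bar R :=
  (q.1 0 j * E * cos (q.2 * dot q.1 t + B))%:E.
have GE (q : 'rV[R]_d * measurableTypeR R) :
    (\int[P]_w (q.1 0 j * cos (dot t (shifted (q, w)) + a))%:E)%E = G q.
  have icos := integrable_cos P (q.2 * dot q.1 t + a) (measurable_dotX X t).
  transitivity (\int[P]_w ((q.1 0 j)%:E *
      (cos (dot t (X w) + (q.2 * dot q.1 t + a)))%:E))%E.
    apply: eq_integral => w _; rewrite -EFinM; congr (_ * cos _)%:E.
    by rewrite /shifted dotDr dotZr (dotC t q.1) addrA.
  rewrite integralZl// -EFin_Rintegral// (mggc_cosE X_mggc) -EFinM /G /B.
  by rewrite [phase nu t + _]addrCA mulrA.
have HE (s : 'rV[R]_d) : (\int[exp_law]_z G (s, z))%E =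
    (E * cos B * ((1 + dot s t ^+ 2)^-1 * s 0 j) -
     E * sin B * (dot s t / (1 + dot s t ^+ 2) * s 0 j))%:E.
  have icos : exp_law.-integrable setT (EFin \o (fun z : R => cos (z * dot s t + B))).
    by apply: integrable_cos; exact: measurable_funM.
  under eq_integral do rewrite /G /= EFinM.
  rewrite integralZl// -EFin_Rintegral// Rintegral_exp_cos -EFinM.
  by congr EFin; ring.
have iG : jump.-integrable setT G.
  have := integrable_fubini_F ijoint; apply: eq_integrable => // q _.
  exact: GE.
have -> : \int[joint]_p (p.1.1 0 j * cos (dot t (shifted p) + a)) =
    \int[nu]_s (E * cos B * ((1 + dot s t ^+ 2)^-1 * s 0 j) -
     E * sin B * (dot s t / (1 + dot s t ^+ 2) * s 0 j)).
  rewrite /Rintegral integral_product_with//.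
  rewrite (eq_integral G); last by move=> q _; exact: GE.
  rewrite integral_product_with//.
  by congr fine; apply: eq_integral => s _; exact: HE.
rewrite RintegralB//; last 2 first.
- by have := integrableZl measurableT (E * cos B) ib; apply: eq_integrable.
- by have := integrableZl measurableT (E * sin B) ic; apply: eq_integrable.
rewrite !RintegralZl// /Rintegral !integral_orthant; last 2 first.
- exact: measurable_int ic.
- exact: measurable_int ib.
by ring.
Qed.

(** The difference of the two sides is a bounded functional of h that vanishes on the
    trigonometric functions. *)
Lemma size_bias_bounded h j : bounded_borel h ->
  \int[P]_w (X w 0 j * h (X w)) = \int[joint]_p (p.1.1 0 j * h (shifted p)).
Proof.
move=> bh; apply/eqP; rewrite -subr_eq0; apply/eqP.
apply: (bounded_functional_eq0 (bounded_functionalB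
  (weighted_bounded_functional (mggc_coord_integrable nu_norm X_mggc j) (measurable_funP X))
  (weighted_bounded_functional (joint_integrable_coord j) measurable_shifted))) => //.
by move=> t a; rewrite size_bias_cos subrr.
Qed.

Lemma size_bias_bounded_dot (f : 'rV[R]_d -> 'rV[R]_d) :
  (forall i, bounded_borel (fun x => f x 0 i)) ->
  (\int[P]_w (dot (X w) (f (X w)))%:E =
   \int[joint]_p (dot p.1.1 (f (shifted p)))%:E)%E.
Proof.
move=> bf; rewrite /dot; under eq_integral do rewrite -sumEFin.
have iX i := integrable_weighted (mggc_coord_integrable nu_norm X_mggc i)
  (measurable_funP X) (bf i).
have iJ i := integrable_weighted (joint_integrable_coord i) measurable_shifted (bf i).
rewrite integral_sum//.
under [RHS]eq_integral do rewrite -sumEFin.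
rewrite [RHS]integral_sum//; apply: eq_bigr => i _.
transitivity (\int[P]_w (X w 0 i * f (X w) 0 i))%:E;
  last by rewrite (size_bias_bounded _ (bf i)) EFin_Rintegral//; exact: iJ.
by rewrite EFin_Rintegral//; exact: iX.
Qed.

(** The whole vector is cut off, not its coordinates, so that the scalar product
    with any other vector is either kept or replaced by 0. *)
Definition truncate (f : 'rV[R]_d -> 'rV[R]_d) (n : nat) x : 'rV[R]_d :=
  (if enorm (f x) <= n%:R then 1 else 0) *: f x.

Lemma dot_truncate (f : 'rV[R]_d -> 'rV[R]_d) n (s x : 'rV[R]_d) : dot s (truncate f n x) =
  (if enorm (f x) <= n%:R then 1 else 0) * dot s (f x).
Proof. exact: dotZr. Qed.

Lemma truncate_bounded (f : 'rV[R]_d -> 'rV[R]_d) n i : measurable_fun setT f ->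
  bounded_borel (fun x => truncate f n x 0 i).
Proof.
move=> mf; split.
  rewrite /truncate; under eq_fun do rewrite mxE.
  apply: measurable_funM; last exact: measurableT_comp (measurable_coord i) mf.
  apply: measurable_fun_ifT => //; apply: measurable_fun_ler => //.
  exact: measurableT_comp measurable_enorm mf.
exists n%:R => x; rewrite /truncate mxE; case: ifPn => [fn|_].
  by rewrite mul1r (le_trans (abs_coord_le_enorm _ _)).
by rewrite mul0r normr0.
Qed.

Lemma cvg_integral_truncate {dT} {T : measurableType dT} (m : {measure set T -> \bar R})
    (s Z : T -> 'rV[R]_d)
    (f : 'rV[R]_d -> 'rV[R]_d) : measurable_fun setT f ->
  measurable_fun setT s -> measurable_fun setT Z ->
  m.-integrable setT (fun y => (dot (s y) (f (Z y)))%:E) ->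
  (\int[m]_y (dot (s y) (truncate f n (Z y)))%:E @[n --> \oo] -->
   \int[m]_y (dot (s y) (f (Z y)))%:E)%E.
Proof.
move=> mf ms mZ ifs.
apply: (@dominated_cvg _ _ _ _ _ measurableT _ _ (fun y => `|(dot (s y) (f (Z y)))%:E|)%E).
- move=> n; apply/measurable_EFinP; apply: measurable_dot => //.
  apply: measurable_rV => i.
  exact: measurableT_comp (truncate_bounded n i mf).1 mZ.
- move=> y _; apply: cvg_near_cst.
  near=> n; rewrite dot_truncate ifT ?mul1r//.
  by near: n; exact: nbhs_infty_ger.
- by [].
- exact: integrable_abse.
- move=> n y _; rewrite dot_truncate !abse_EFin lee_fin normrM ler_piMl//.
  by case: ifP; rewrite ?normr1 ?normr0.
Unshelve. all: by end_near. Qed.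

Lemma size_bias_dot (f : 'rV[R]_d -> 'rV[R]_d) : measurable_fun setT f ->
  P.-integrable setT (fun w => (dot (X w) (f (X w)))%:E) ->
  joint.-integrable setT (fun p : space => (dot p.1.1 (f (shifted p)))%:E) ->
  (\int[P]_w (dot (X w) (f (X w)))%:E =
   \int[joint]_p (dot p.1.1 (f (shifted p)))%:E)%E.
Proof.
move=> mf iX iJ.
have m1 : measurable_fun setT (fun p : space => p.1.1).
  exact: measurableT_comp measurable_fst measurable_fst.
have cX := cvg_integral_truncate mf (measurable_funP X) (measurable_funP X) iX.
have cJ := cvg_integral_truncate mf m1 measurable_shifted iJ.
have XJ n := size_bias_bounded_dot (fun i => truncate_bounded n i mf).
move: cX; rewrite (funext XJ) => cX.
exact: cvg_unique cX cJ.
Qed.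

End size_bias.

(** * Measurability and sigma-finiteness *)

Section parameter_integrals.
Context {d1 d2} {T1 : measurableType d1} {T2 : measurableType d2} {R : realType}.
Local Open Scope ereal_scope.

Lemma measurable_integral_snd (m : {sigma_finite_measure set T2 -> \bar R})
    (g : T1 * T2 -> \bar R) : measurable_fun setT g ->
  measurable_fun setT (fun x => \int[m]_y g (x, y)).
Proof.
move=> mg.
rewrite [X in measurable_fun _ X](_ : _ = fun x =>
    \int[m]_y g^\+ (x, y) - \int[m]_y g^\- (x, y)); last first.
  by apply/funext => x; rewrite integralE; congr (_ - _); apply: eq_integral => y _;
    rewrite ?funeposE ?funenegE.
by apply: emeasurable_funB; apply: measurable_fun_fubini_tonelli_F => //;
  [exact: measurable_funepos|exact: measurable_funeneg].
Qed.

Lemma measurable_integral_fst (m : {sigma_finite_measure set T1 -> \bar R})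
    (g : T1 * T2 -> \bar R) : measurable_fun setT g ->
  measurable_fun setT (fun y => \int[m]_x g (x, y)).
Proof.
move=> mg.
rewrite [X in measurable_fun _ X](_ : _ = fun y =>
    \int[m]_x g^\+ (x, y) - \int[m]_x g^\- (x, y)); last first.
  by apply/funext => y; rewrite integralE; congr (_ - _); apply: eq_integral => x _;
    rewrite ?funeposE ?funenegE.
by apply: emeasurable_funB; apply: measurable_fun_fubini_tonelli_G => //;
  [exact: measurable_funepos|exact: measurable_funeneg].
Qed.

End parameter_integrals.

Section exponential_variable.
Context {R : realType} {disp} {O : measurableType disp} (P : probability O R).
Local Open Scope ereal_scope.

(** Change of variables, on the positive and the negative part of h separately since
    either integral may be infinite. *)
Lemma integral_exp1_distributed (E : {RV P >-> R}) (h : R -> \bar R) :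
  exp1_distributed E -> measurable_fun setT h ->
  \int[P]_w h (E w) = \int[exp_law]_z h z.
Proof.
move=> lawE; suff ge0 (k : R -> \bar R) : measurable_fun setT k ->
    (forall z, 0 <= k z) -> \int[P]_w k (E w) = \int[exp_law]_z k z.
  move=> mh; rewrite integralE [RHS]integralE; congr (_ - _).
    rewrite -ge0//; last exact: measurable_funepos.
    by apply: eq_integral => w _; rewrite !funeposE.
  rewrite -ge0//; last exact: measurable_funeneg.
  by apply: eq_integral => w _; rewrite !funenegE.
move=> mk k0.
pose E' : O -> measurableTypeR R := E.
have mE' : measurable_fun setT E' by exact: (measurable_funP E).
rewrite -[LHS](@ge0_integral_pushforward _ _ _ (measurableTypeR R) _ E' mE' P setT k)//.
apply: (eq_measure_integral exp_law) => A mA _.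
exact: lawE.
Qed.

End exponential_variable.

Section radon.
Context {R : realType} {d : nat} (nu : {measure set 'rV[R]_d -> \bar R}).

Lemma radon_sigma_finite : radon nu -> sigma_finite setT nu.
Proof.
move=> [nuK _].
pose K (n : nat) : set 'rV[R]_d := [set s | forall i, `[(- n%:R), n%:R]%classic (s 0 i)].
exists K => [|n].
  apply/seteqP; split => // s _.
  exists (Num.bound (enorm s)) => // i; rewrite /= in_itv /= -ler_norml.
  rewrite (le_trans (abs_coord_le_enorm s i))// ltW//.
  by rewrite archi_boundP// sqrtr_ge0.
split; first exact: measurable_coord_box.
by apply: nuK; apply: (@rV_compact R d (fun=> `[(- n%:R), n%:R]%classic)) => i; exact: segment_compact.
Qed.

End radon.

Section sigma_finite_copy.
Context {dT} {T : measurableType dT} {R : realType} (nu : {measure set T -> \bar R}).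

(** The proof is an argument so that the sigma-finite structure can be inferred from
    the term. *)
Definition sigma_finite_copy of sigma_finite setT nu : set T -> \bar R := nu.

Hypothesis nu_sf : sigma_finite setT nu.

HB.instance Definition _ := Measure.copy (sigma_finite_copy nu_sf) nu.
HB.instance Definition _ :=
  Measure_isSigmaFinite.Build _ _ _ (sigma_finite_copy nu_sf) nu_sf.

Lemma sigma_finite_measureP : exists nu' : {sigma_finite_measure set T -> \bar R},
  nu = nu' :> {measure set T -> \bar R}.
Proof. by exists (sigma_finite_copy nu_sf); exact: eq_measure. Qed.

End sigma_finite_copy.

Lemma EFin_Rintegral_fine {dT} {T : measurableType dT} {R : realType}
    (m : {measure set T -> \bar R}) (g : T -> \bar R) :
  m.-integrable setT g -> ((\int[m]_x fine (g x))%:E = \int[m]_x g x)%E.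
Proof.
move=> ig; have mg := measurable_int _ ig.
have gE : (\int[m]_x (fine (g x))%:E = \int[m]_x g x)%E.
  apply: ae_eq_integral => //.
    by apply/measurable_EFinP; apply: measurableT_comp mg; exact: fine_measurable.
  have := integrable_ae measurableT ig.
  by apply: filterS => x gx _; rewrite fineK//; exact: gx.
by rewrite /Rintegral gE fineK//; exact: integrable_fin_num.
Qed.

Lemma expectation_integral {dT} {T : measurableType dT} {R : realType}
  (P : probability T R) (Y : T -> R) : ('E_P[Y] = \int[P]_w (Y w)%:E)%E.
Proof. by rewrite unlock. Qed.

(** * The Stein operator *)

Section stein_identity.
Context {disp : measure_display} {O : measurableType disp} {R : realType}.
Context {d : nat} (P : probability O R) (X : {RV P >-> 'rV[R]_d}).
Variable nu : {sigma_finite_measure set 'rV[R]_d -> \bar R}.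
Hypothesis nu_orthant : nu (~` orthant) = 0%E.
Hypothesis nu_norm : (\int[nu]_(s in orthant) (enorm s)%:E < +oo)%E.
Hypothesis X_mggc : mggc X nu.
Implicit Types f : 'rV[R]_d -> 'rV[R]_d.

Notation plane := ('rV[R]_d * measurableTypeR R)%type.
Notation space := (('rV[R]_d * measurableTypeR R) * O)%type.
Notation jump := (product_with nu exp_law).
Notation joint := (product_with jump P).

(** The iterated integrals of the statement are integrals against nu and the
    exponential law: nu does not charge the complement of the orthant, and the factor
    e^(-z) on the half-line is the density. *)
Lemma nested_integralE (g : plane -> \bar R) : measurable_fun setT g ->
  (\int[nu]_(s in orthant) \int[lebesgue_measure]_(z in `[0%R, +oo[)
     ((expR (- z))%:E * g (s, z)) = \int[nu]_s \int[exp_law]_z g (s, z))%E.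
Proof.
move=> mg; rewrite -(integral_orthant nu_orthant); last exact: measurable_integral_snd.
apply: eq_integral => s _; rewrite integral_exp_law//.
exact: measurableT_comp mg (pair1_measurable s).
Qed.

(** The integrand of the nonlocal term of the operator at x, as a function of (s, z). *)
Definition jump_dot f x (q : plane) : R := dot q.1 (f (x + q.2 *: q.1)).

Lemma measurable_jump_dot f : measurable_fun setT f ->
  measurable_fun setT (fun p : space => jump_dot f (X p.2) p.1).
Proof.
move=> mf; apply: measurable_dot; first exact: measurableT_comp measurable_fst measurable_fst.
exact: measurableT_comp mf (measurable_shifted X).
Qed.

Lemma measurable_jump_dot_cst f x : measurable_fun setT f ->
  measurable_fun setT (jump_dot f x).
Proof.
move=> mf; apply: measurable_dot => //; apply: measurableT_comp mf _.
apply: measurable_rV => i; under eq_fun do rewrite !mxE.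
apply: measurable_funD => //; apply: measurable_funM; first exact: measurable_snd.
exact: measurableT_comp (measurable_coord i) measurable_fst.
Qed.

Lemma inner_exp_integral f x s : measurable_fun setT f ->
  (\int[lebesgue_measure]_(z in `[0%R, +oo[)
     (expR (- z) * dot s (f (x + z *: s)))%:E =
   \int[exp_law]_z (jump_dot f x (s, z))%:E)%E.
Proof.
move=> mf; rewrite integral_exp_law//; apply/measurable_EFinP.
exact: measurableT_comp (measurable_jump_dot_cst x mf) (pair1_measurable s).
Qed.

Lemma stein_opE f x : measurable_fun setT f -> stein_op nu f x =
  dot x (f x) - \int[nu]_s \int[exp_law]_z jump_dot f x (s, z).
Proof.
move=> mf; rewrite /stein_op; congr (_ - fine _).
rewrite -(integral_orthant nu_orthant).
  by apply: eq_integral => s _; rewrite /Rintegral inner_exp_integral.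
apply/measurable_EFinP; apply: measurableT_comp; first exact: fine_measurable.
apply: (measurable_integral_snd exp_law (g := fun q => (jump_dot f x q)%:E)).
by apply/measurable_EFinP; exact: measurable_jump_dot_cst.
Qed.

(** The inner integrals agree for every s, as extended real numbers. *)
Lemma stein_op_rvE f x {disp'} {O' : measurableType disp'} (P' : probability O' R)
    (E : {RV P' >-> R}) : measurable_fun setT f -> exp1_distributed E ->
  stein_op nu f x = stein_op_rv nu E f x.
Proof.
move=> mf lawE; congr (_ - _); apply: eq_Rintegral => s _.
rewrite /Rintegral inner_exp_integral// expectation_integral.
congr fine; rewrite -(integral_exp1_distributed lawE)//.
apply/measurable_EFinP.
exact: measurableT_comp (measurable_jump_dot_cst x mf) (pair1_measurable s).
Qed.

Lemma stein_domP f x : measurable_fun setT f ->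
  jump.-integrable setT (EFin \o jump_dot f x) -> stein_dom nu f x.
Proof.
move=> mf; have mj := measurable_jump_dot_cst x mf.
have mj' : measurable_fun setT (fun q => `|(jump_dot f x q)%:E|)%E.
  by apply: measurableT_comp => //; exact/measurable_EFinP.
move=> /integrable12ltyP; rewrite -(nested_integralE mj'); apply.
exact/measurable_EFinP.
Qed.

Section stein_class_member.
Variable f : 'rV[R]_d -> 'rV[R]_d.
Hypothesis fF : stein_class X nu f.

Let mf : measurable_fun setT f.
Proof. by case: fF. Qed.

Let mF : measurable_fun setT (fun p : space => (jump_dot f (X p.2) p.1)%:E).
Proof. by apply/measurable_EFinP; exact: measurable_jump_dot. Qed.

Lemma stein_class_integrable : P.-integrable setT (fun w => (dot (X w) (f (X w)))%:E).
Proof.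
have [_ + _] := fF; rewrite expectation_integral => fX; apply/integrableP; split=> //.
by apply/measurable_EFinP; apply: measurable_dot => //; exact: measurableT_comp mf _.
Qed.

Lemma stein_class_joint_integrable :
  joint.-integrable setT (fun p => (jump_dot f (X p.2) p.1)%:E).
Proof.
apply/integrable12ltyP => //.
have mG : measurable_fun setT (fun q => \int[P]_w `|(jump_dot f (X w) q)%:E|)%E.
  apply: (measurable_integral_snd P (g := fun p : space => `|(jump_dot f (X p.2) p.1)%:E|%E)).
  exact: measurableT_comp.
rewrite fubini_tonelli1//; last by move=> q; exact: integral_ge0.
have [_ _] := fF; congr (_ < _)%E; apply: etrans (nested_integralE mG).
apply: eq_integral => s _; apply: eq_integral => z _; congr *%E.
by rewrite expectation_integral.
Qed.

Lemma stein_identity : ('E_P[(fun w => dot (X w) (f (X w)))%R] =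
  \int[nu]_(s in orthant) \int[lebesgue_measure]_(z in `[0%R, +oo[)
    ((expR (- z))%:E * 'E_P[(fun w => dot s (f (X w + z *: s)))%R]))%E.
Proof.
have iF := stein_class_joint_integrable.
rewrite expectation_integral.
rewrite (size_bias_dot nu_orthant nu_norm X_mggc mf stein_class_integrable iF).
have iG := integrable_fubini_F iF.
rewrite integral_product_with// integral_product_with//.
rewrite -(nested_integralE (measurable_int _ iG)).
apply: eq_integral => s _; apply: eq_integral => z _; congr *%E.
by rewrite expectation_integral.
Qed.

(** The nonlocal term at X w is the iterated integral J w of the real parts of
    possibly infinite inner integrals. For almost every w it is the integral H w over
    the product of nu and the exponential law; where it is not, J is still measurable in
    w, which makes it integrable. Its mean is the right-hand side of the identity. *)
Lemma stein_operator_stein_class :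
  [/\ {ae P, forall w, stein_dom nu f (X w)},
      P.-integrable setT (fun w => (stein_op nu f (X w))%:E) &
      ('E_P[(fun w => stein_op nu f (X w))%R] = 0)%E].
Proof.
have iF := stein_class_joint_integrable.
have aeF := ae_integrable2 iF.
pose J w := \int[nu]_s \int[exp_law]_z jump_dot f (X w) (s, z).
pose H w := (\int[jump]_q (jump_dot f (X w) q)%:E)%E.
have mJ : measurable_fun setT (fun w => (J w)%:E).
  apply/measurable_EFinP; apply: measurableT_comp; first exact: fine_measurable.
  apply: (measurable_integral_fst nu (g := fun p : 'rV[R]_d * O =>
    (\int[exp_law]_z jump_dot f (X p.2) (p.1, z))%:E)).
  apply/measurable_EFinP; apply: measurableT_comp; first exact: fine_measurable.
  apply: (measurable_integral_snd exp_law (g := fun p : ('rV[R]_d * O) * measurableTypeR R =>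
    (jump_dot f (X p.1.2) (p.1.1, p.2))%:E)).
  have mperm : measurable_fun setT (fun p : ('rV[R]_d * O) * measurableTypeR R =>
      (((p.1.1, p.2), p.1.2) : space)).
    apply: measurable_fun_pair; last exact: measurableT_comp measurable_snd measurable_fst.
    apply: measurable_fun_pair; last exact: measurable_snd.
    exact: measurableT_comp measurable_fst measurable_fst.
  exact: measurableT_comp mF mperm.
have JH w : jump.-integrable setT (EFin \o jump_dot f (X w)) -> (J w)%:E = H w.
  move=> ij; rewrite /H integral_product_with//.
  exact: EFin_Rintegral_fine (integrable_fubini_F ij).
have aeJ : {ae P, forall w, (J w)%:E = H w}.
  by apply: filterS aeF => w; exact: JH.
have mH : measurable_fun setT H by exact: measurable_fubini_G iF.
have iJ : P.-integrable setT (EFin \o J).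
  apply/integrableP; split=> //.
  have /(integrable21ltyP _ _ mF) := iF; apply: le_lt_trans.
  apply: ae_ge0_le_integral => //.
  - exact: measurableT_comp.
  - by move=> w _; exact: integral_ge0.
  - apply: (measurable_integral_fst jump
      (g := fun p : space => `|(jump_dot f (X p.2) p.1)%:E|%E)).
    exact: measurableT_comp.
  - apply: filterS aeJ => w Jw _.
    have -> : (`|(EFin \o J) w| = `|H w|)%E by rewrite -Jw.
    apply: le_abse_integral => //.
    by apply/measurable_EFinP; exact: measurable_jump_dot_cst.
have intJ : (\int[P]_w (J w)%:E = \int[joint]_p (jump_dot f (X p.2) p.1)%:E)%E.
  rewrite -(integral21_prod_meas1 iF); apply: ae_eq_integral => //.
  by apply: filterS aeJ => w Jw _.
have opE w : (stein_op nu f (X w))%:E = ((dot (X w) (f (X w)))%:E - (J w)%:E)%E.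
  by rewrite stein_opE.
split.
- by apply: filterS aeF => w ij; exact: (@stein_domP f (X w) mf ij).
- under eq_fun do rewrite opE.
  by apply: integrableB => //; exact: stein_class_integrable.
- rewrite expectation_integral; under eq_integral do rewrite opE.
  rewrite integralB//; last exact: stein_class_integrable.
  rewrite intJ (size_bias_dot nu_orthant nu_norm X_mggc mf stein_class_integrable iF).
  by rewrite subee//; exact: integrable_fin_num.
Qed.

End stein_class_member.
End stein_identity.

Theorem theorem4p2 (R : realType) (d : nat) (hd : (0 < d)%N)
    (disp : measure_display) (O : measurableType disp) (P : probability O R)
    (X : {RV P >-> 'rV[R]_d}) (nu : {measure set 'rV[R]_d -> \bar R})
    (nu_thorin : thorin_measure nu)
    (nu_norm : (\int[nu]_(s in orthant) (enorm s)%:E < +oo)%E)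
    (X_mggc : mggc X nu) :
  [/\ (* the two expressions of the operator agree *)
      forall f, stein_class X nu f ->
        forall (disp' : measure_display) (O' : measurableType disp')
          (P' : probability O' R) (E : {RV P' >-> R}),
        exp1_distributed E ->
        forall x, stein_dom nu f x -> stein_op nu f x = stein_op_rv nu E f x,
      stein_operator X (stein_class X nu) (stein_dom nu) (stein_op nu) &
      forall f, stein_class X nu f ->
        ('E_P[(fun w => dot (X w) (f (X w)))%R] =
         \int[nu]_(s in orthant) \int[lebesgue_measure]_(z in `[0%R, +oo[)
           ((expR (- z))%:E * 'E_P[(fun w => dot s (f (X w + z *: s)))%R]))%E].
Proof.
have [nu_radon nu_orthant _ _] := nu_thorin.
have [nu' E] := sigma_finite_measureP (radon_sigma_finite nu_radon).
move: nu_orthant nu_norm X_mggc; rewrite E => nu_orthant' nu_norm' X_mggc'.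
split.
- move=> f [mf _ _] disp' O' P' V lawV x _.
  exact: stein_op_rvE.
- by move=> f fF; exact: stein_operator_stein_class fF.
- by move=> f fF; exact: stein_identity fF.
Qed.
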